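(* Assume that the scheme is Cauchy-stable, i.e. $\left|\sum_{k=-r}^{p} a_k e^{ik\xi}\right|\leq 1$ for all $\xi\in\mathbb{R}$. Let $\Delta$ be the intrinsic Kreiss-Lopatinskii determinant and let $\Delta(\mathbb{S})$ be the closed parametrized curve $\theta\in[0,2\pi]\mapsto\Delta(e^{i\theta})$. If $0\notin\Delta(\mathbb{S})$, then the equation $\Delta(z)=0$ has exactly $r-\mathrm{Ind}_{\Delta(\mathbb{S})}(0)$ zeros (counted with multiplicity) in $\mathcal{U}=\{z\in\mathbb{C}:|z|>1\}$, where $\mathrm{Ind}_{\Delta(\mathbb{S})}(0)$ is the winding number of the origin with respect to the oriented closed curve $\Delta(\mathbb{S})$.
   Context: Notation: $\mathbb{S}=\{|z|=1\}$, $\mathbb{D}=\{|z|<1\}$, $\mathcal{U}=\{|z|>1\}$, $\overline{\mathcal{U}}=\{|z|\geq 1\}$ in $\mathbb{C}$. Scheme: let $r,p\geq 1$ be integers, $a_{-r},\dots,a_p$ complex coefficients with $a_{-r}\neq 0$ and $a_p\neq 0$, $m\geq p+r$ an integer, and $(b_{j,k})_{-r\leq j\leq -1,\ 0\leq k\leq m-1}$ complex coefficients. The scheme is $$U_j^{n+1}=\sum_{k=-r}^{p}a_kU_{j+k}^n\ (j\geq 0,\,n\geq0),\qquad U_j^n=\sum_{k=0}^{m-1}b_{j,k}U_k^n+g_j^n\ (-r\leq j\leq -1,\,n\geq 0),\qquad U_j^0=f_j\ (j\geq 0).$$ The boundary matrix $\mathcal{B}\in\mathcal{M}_{r,m}(\mathbb{C})$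 (rows indexed by $i=0,\dots,r-1$, columns by $k=0,\dots,m-1$) obtained by eliminating the ghost values $U_j^n$, $-r\leq j\leq -1$, from the first $r$ interior equations is $$\mathcal{B}_{i,k}=a_{k-i}+\sum_{l=-r}^{-1}a_{l-i}\,b_{l,k},\qquad\text{with the convention } a_q=0 \text{ if } q\notin\{-r,\dots,p\}.$$ Roots: the characteristic equation, with unknown $\kappa$ and parameter $z$, is $z\kappa^r=\sum_{k=-r}^{p}a_k\kappa^{r+k}$. Under Cauchy-stability, for $z\in\mathcal{U}$ it has exactly $r$ roots in $\mathbb{D}$ and $p$ roots in $\mathcal{U}$, counted with multiplicity, and none on $\mathbb{S}$. For $z\in\mathcal{U}$, let $\kappa_1(z),\dots,\kappa_M(z)$ be the distinct roots in $\mathbb{D}$, with multiplicities $\beta_1,\dots,\beta_M$, $\beta_1+\dots+\beta_M=r$. For $z\in\mathbb{S}$, the same notation denotes the $r$ roots (in $\overline{\mathbb{D}}$) ''coming from the inside'', i.e. the limit, as $z'\to z$ with $z'\in\mathcal{U}$, of the multiset of the $r$ roots in $\mathbb{D}$ for $z'$; $\kappa_1(z),\dots,\kappa_M(z)$ are its distinct elements and $\beta_1,\dots,\beta_M$ their multiplicities in this limit multiset. Matrices: for $0\leq i<j$ (and $i=j$ when $r=1$), $K_{i,j}(z)\in\mathcal{M}_{j-i+1,r}(\mathbb{C})$ is the matrix whose $r$ columns are the rows of index $i$ to $j$ (included, indices starting at $0$) of the $r$ sequences $(q^{s}\kappa_\ell(z)^q)_{q\geq 0}$, $\ell=1,\dots,M$,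 $s=0,\dots,\beta_\ell-1$ (convention $0^0=1$), the columns being ordered in the same way for all $K_{i,j}(z)$ at a given $z$. The intrinsic Kreiss-Lopatinskii determinant is, for $z\in\overline{\mathcal{U}}$, $$\Delta(z)=\frac{\det\left(zK_{0,r-1}(z)-\mathcal{B}K_{0,m-1}(z)\right)}{\det K_{0,r-1}(z)}.$$ It does not depend on the ordering of the columns. It is holomorphic on $\mathcal{U}$ and continuous on $\overline{\mathcal{U}}$, so the curve $\Delta(\mathbb{S})$ is continuous. *)

(* Defs.v *)
From HB Require Import structures.
From mathcomp Require Import all_boot all_order all_algebra.
From mathcomp Require Import complex.
From mathcomp Require Import all_classical all_reals all_analysis.

Set Implicit Arguments.
Unset Strict Implicit.
Unset Printing Implicit Defensive.

Import Order.TTheory GRing.Theory Num.Theory.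
Import numFieldNormedType.Exports.

Local Open Scope classical_set_scope.
Local Open Scope ring_scope.

(* The bare type R[i] has no canonical topology; seen as a numClosedFieldType  *)
(* it gets the one of the modulus.                                             *)
Definition cplx (R : realType) : numClosedFieldType := R[i]%C.

Definition expi (R : realType) (t : R) : cplx R := (cos t +i* sin t)%C.

Section Complex_analysis.
Variable R : realType.
Local Notation C := (cplx R).

(* ind is the winding number around c of the closed curve g : [u, v] -> C,     *)
(* i.e. the total variation, over 2 pi, of a continuous argument of g - c.     *)
Definition winding_number (g : R -> C) (u v : R) (c : C) (ind : int) : Prop :=
  [/\ {within `[u, v], continuous g},
      g u = g v,
      (forall t, t \in `[u, v] -> g t != c) &
      exists phi : R -> R,
        [/\ {within `[u, v], continuous phi},
            (forall t, t \in `[u, v] ->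
               g t - c = `|g t - c| * expi (phi t)) &
            phi v - phi u = 2 * pi * ind%:~R]].

Definition zero_order (f : C -> C) (z : C) (k : nat) : Prop :=
  exists h : C -> C,
    [/\ \forall w \near z, derivable h w 1,
        h z != 0 &
        \forall w \near z, f w = (w - z) ^+ k * h w].

Definition has_zeros (f : C -> C) (A : set C) (N : nat) : Prop :=
  exists (zs : seq C) (mu : C -> nat),
    [/\ uniq zs,
        (forall z, z \in zs <-> A z /\ f z = 0),
        (forall z, z \in zs -> zero_order f z (mu z)) &
        N = (\sum_(z <- zs) mu z)%N].

End Complex_analysis.

(* The scheme is given by r, p, m, by a_q = a q for -r <= q <= p and by        *)
(* b_{l,k} = b l k for -r <= l <= -1 and 0 <= k <= m - 1; the values of a and  *)
(* b outside these ranges are never used.  A sum over -r <= q <= p is indexed  *)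
(* by k = q + r < r + p + 1.                                                   *)
Section Scheme.
Variable R : realType.
Local Notation C := (cplx R).
Variables (r p m : nat) (a : int -> C) (b : int -> nat -> C).

Definition cauchy_stable : Prop :=
  forall xi : R,
    `| \sum_(k < (r + p).+1)
         a (k%:Z - r%:Z) * expi ((k%:Z - r%:Z)%:~R * xi) | <= 1.

Definition acoef (q : int) : C :=
  if (- r%:Z <= q) && (q <= p%:Z) then a q else 0.

Definition boundary_mx : 'M[C]_(r, m) :=
  \matrix_(i < r, k < m)
    (acoef (k%:Z - i%:Z) +
     \sum_(l < r) acoef (l%:Z - r%:Z - i%:Z) * b (l%:Z - r%:Z) k).

Definition charac_poly (z : C) : {poly C} :=
  \sum_(k < (r + p).+1) a (k%:Z - r%:Z) *: 'X^k - z *: 'X^r.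

Definition roots_in_disc (z : C) : seq C :=
  [seq x <- sval (closed_field_poly_normal (charac_poly z)) | `|x| < 1].

(* Convergence of multisets of r elements, represented by sequences up to      *)
(* permutation.                                                                *)
Definition limit_roots (z : C) (s : seq C) : Prop :=
  size s = r /\
  forall e : C, 0 < e -> \forall z' \near z, 1 < `|z'| ->
    exists s' : seq C,
      [/\ perm_eq s' (roots_in_disc z'), size s' = r &
          forall i, (i < r)%N -> `|s'`_i - s`_i| < e].

(* For |z| = 1 the limit multiset is unique, so the choice made by xget only   *)
(* affects the order of the elements.  Junk value for |z| < 1.                 *)
Definition inside_roots (z : C) : seq C :=
  if 1 < `|z| then roots_in_disc z else xget [::] [set s | limit_roots z s].

(* The pairs (kappa_l, s) with 0 <= s < beta_l.                                *)
Definition root_columns (z : C) : seq (C * nat) :=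
  flatten [seq [seq (x, s) | s <- iota 0 (count_mem x (inside_roots z))]
          | x <- undup (inside_roots z)].

(* The matrix K_{0,n-1}(z); here 0 ^+ 0 = 1.                                   *)
Definition K_mx (n : nat) (z : C) : 'M[C]_(n, r) :=
  \matrix_(q < n, c < r)
    let: (x, s) := nth (0, 0%N) (root_columns z) c in
    (q : nat)%:R ^+ s * x ^+ q.

Definition KL_det (z : C) : C :=
  \det (z *: K_mx r z - boundary_mx *m K_mx m z) / \det (K_mx r z).

End Scheme.

(* Main.v *)
Require Import Defs.
From mathcomp Require Import all_boot all_order all_algebra.
From mathcomp Require Import complex.
From mathcomp Require Import all_classical all_reals all_analysis.
From mathcomp Require Import ring lra zify.
Import Order.TTheory GRing.Theory Num.Theory.
Import numFieldNormedType.Exports.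
Local Open Scope classical_set_scope.
Local Open Scope ring_scope.

(** Put w = 1/z, which turns the exterior of the unit circle into the unit
    disc, and write Delta(z) = z^r G(w).  When G is in the disc algebra, has no
    zero on the circle and G(0) = 1, the argument principle
    ([argument_principle]) equates its number n of zeros in the disc with its
    winding number along the circle.  Since Delta(e^(it)) = e^(irt) G(e^(-it))
    and inversion reverses orientation, Delta has index r - n along the circle,
    while it has n zeros in the exterior ([exterior_zeros]).

    Reduction to power sums.  Let Q be the product of the X - kappa over the r
    inside roots.  A sequence q^s kappa^q, with s less than the multiplicity of
    kappa in Q, satisfies the linear recurrence of Q; hence row q of the
    matrices K is the combination of their first r rows given by the
    coefficients of X^q modulo Q ([conf_mx_factor]), and K_{0,m-1} = C K_{0,r-1}
    for the matrix C of these coefficients.  As no root vanishes, K_{0,r-1} is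
    an invertible confluent Vandermonde matrix ([conf_mx_unit]), and Delta(z) =
    det (z - B C).  The entries of C are polynomials in the coefficients of Q,
    so, by Newton's identities, in the power sums of the inside roots: G is in
    the disc algebra as soon as these power sums are
    ([disc_alg_det_rem], [disc_alg_psum_family]).

    Power sums inside the disc.  For |w| < 1, Cauchy stability keeps the roots
    of chi off the unit circle and Rouché's theorem places r of them inside, so
    that the q-th power sum is the integral over the circle of x^q chi'/chi,
    divided by 2 i pi.  Its trapezoidal sums over the N-th roots of unity are
    rational functions of w with poles outside the closed disc, and they
    converge uniformly on smaller discs because the roots stay at a positive
    distance from the circle there ([root_gap], [disc_alg_psum]).

    Power sums on the boundary.  Near a point w0 of the circle, the inside
    roots are close to roots of the equation at w0, so that the tuple of the
    inside roots is close to one of finitely many tuples.  The value of Q at a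
    well chosen point tells these tuples apart, up to order; it is continuous
    in w and the part of the open disc near w0 is convex, so a single one of
    them is approached ([inner_roots_limit]).  This gives both the existence
    of the limit multiset and the continuity of the power sums up to the
    circle.

    Complex analysis.  The disc algebra is taken to be the set of uniform
    limits of polynomials on the closed disc.  The winding number of a
    polynomial is read off its factorization and is stable under small
    perturbations ([rouche]), which gives the maximum principle
    ([max_principle]); therefore the difference quotients of an element of the
    disc algebra are again in the disc algebra ([disc_alg_div]).  Zeros can
    thus be divided out, each of them lowering by one a winding number that
    stays nonnegative, until none is left; and then the winding number is zero
    ([has_wind_nonvanishing]). *)

Set Implicit Arguments.
Unset Strict Implicit.
Unset Printing Implicit Defensive.

(** * Complex numbers: real parts, polar form *)

Section ComplexBasics.
Variable R : realType.
Local Notation C := (cplx R).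
Local Notation re := (@complex.Re R).
Local Notation im := (@complex.Im R).

Lemma nearP (z : C) (P : set C) :
  (\forall w \near z, P w) <->
  exists2 d : C, 0 < d & forall w, `|w - z| < d -> P w.
Proof.
split.
  move=> /nbhs_ballP[d d0 H]; exists d => // w wd; apply: H.
  by rewrite /ball /= distrC.
by move=> [d d0 H]; apply/nbhs_ballP; exists d => // w; rewrite /ball /= distrC => /H.
Qed.

(** The norm of [cplx R] takes its values in [cplx R], whose order is partial. *)
Definition cabs (z : C) : R := Num.sqrt (re z ^+ 2 + im z ^+ 2).

Lemma norm_cabs (z : C) : `|z| = (cabs z)%:C%C.
Proof. exact: normc_def. Qed.

Lemma gt0_re (x : C) : 0 < x -> x = (re x)%:C%C /\ 0 < re x.
Proof.
move=> hx; have := hx; rewrite ltcE => /andP[_ h]; split => //.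
by rewrite RRe_real // realE ltW.
Qed.

Lemma cabs_le (z : C) : cabs z <= `|re z| + `|im z|.
Proof.
rewrite -[leRHS]ger0_norm ?addr_ge0 // -sqrtr_sqr; apply: ler_wsqrtr.
rewrite sqrrD !real_normK ?num_real // -addrA [_ *+ 2 + _]addrC addrA lerDl.
by rewrite mulrn_wge0 // mulr_ge0.
Qed.

Lemma re_le_cabs (z : C) : `|re z| <= cabs z.
Proof. by rewrite -sqrtr_sqr ler_wsqrtr // lerDl sqr_ge0. Qed.

Lemma im_le_cabs (z : C) : `|im z| <= cabs z.
Proof. by rewrite -sqrtr_sqr ler_wsqrtr // lerDr sqr_ge0. Qed.

Lemma continuous_cplx (T : topologicalType) (u v : T -> R) (x : T) :
  {for x, continuous u} -> {for x, continuous v} ->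
  {for x, continuous (fun t => (u t +i* v t)%C : C)}.
Proof.
move=> hu hv; apply/cvgrPdist_lt => e e0.
have [ee re0] := gt0_re e0.
have e2 : 0 < re e / 2 by rewrite divr_gt0.
move/cvgrPdist_lt : hu => /(_ _ e2) hu.
move/cvgrPdist_lt : hv => /(_ _ e2) hv.
near=> t.
have h1 : `|u x - u t| < re e / 2 by near: t.
have h2 : `|v x - v t| < re e / 2 by near: t.
rewrite ee norm_cabs ltcR (le_lt_trans (cabs_le _)) //=.
by rewrite (splitr (re e)) ltrD.
Unshelve. all: by end_near. Qed.

Lemma continuous_re : continuous (re : C -> R).
Proof.
move=> z; apply/(@cvgrPdist_lt _ _ _ _ (nbhs_filter z)) => e e0.
apply/nearP; exists e%:C%C; first by rewrite ltcR.
move=> w; rewrite norm_cabs ltcR; apply: le_lt_trans.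
by rewrite distrC; apply: le_trans (re_le_cabs _); case: w z => [a b] [c d].
Qed.

Lemma continuous_im : continuous (im : C -> R).
Proof.
move=> z; apply/(@cvgrPdist_lt _ _ _ _ (nbhs_filter z)) => e e0.
apply/nearP; exists e%:C%C; first by rewrite ltcR.
move=> w; rewrite norm_cabs ltcR; apply: le_lt_trans.
by rewrite distrC; apply: le_trans (im_le_cabs _); case: w z => [a b] [c d].
Qed.

Lemma expiD (s t : R) : expi (s + t) = expi s * expi t.
Proof. by rewrite /expi cosD sinD; rewrite [sin s * _ + _]addrC. Qed.

Lemma expi0 : expi 0 = 1 :> C.
Proof. by rewrite /expi cos0 sin0. Qed.

Lemma norm_expi (t : R) : `|expi t| = 1 :> C.
Proof. by rewrite norm_cabs /cabs /= cos2Dsin2 sqrtr1. Qed.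

Lemma expi_neq0 (t : R) : expi t != 0 :> C.
Proof. by rewrite -normr_eq0 norm_expi oner_eq0. Qed.

Lemma expiN (t : R) : expi (- t) = (expi t)^-1.
Proof. by apply: (mulIf (expi_neq0 t)); rewrite mulVf ?expi_neq0 // -expiD addNr expi0. Qed.

Lemma expi_muln (t : R) n : expi (n%:R * t) = expi t ^+ n.
Proof.
elim: n => [|n IH]; first by rewrite mul0r expi0 expr0.
by rewrite -natr1 mulrDl mul1r expiD IH exprSr.
Qed.

Lemma expi2pi : expi (2 * pi) = 1 :> C.
Proof. by rewrite /expi mulr_natl -[pi *+ 2]add0r cosD2pi sinD2pi cos0 sin0. Qed.

Lemma expipi : expi pi = -1 :> C.
Proof. by rewrite /expi cospi sinpi; apply/eqP; rewrite eq_complex /= oppr0 !eqxx. Qed.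

Lemma continuous_expi : continuous (@expi R).
Proof. by move=> t; apply: continuous_cplx; [exact: continuous_cos|exact: continuous_sin]. Qed.

Lemma expi_surj (z : C) : `|z| = 1 -> exists t, z = expi t.
Proof.
move=> /eqP; rewrite norm_cabs (inj_eq (@complexI _)) => /eqP z1.
have h : re z ^+ 2 + im z ^+ 2 = 1.
  by rewrite -[LHS]sqr_sqrtr ?addr_ge0 ?sqr_ge0 // -/(cabs z) z1 expr1n.
have r1 : -1 <= re z <= 1 by rewrite -ler_norml -z1 re_le_cabs.
have ca : cos (acos (re z)) = re z by rewrite acosK.
have sa : sin (acos (re z)) = `|im z| by rewrite sin_acos // -sqrtr_sqr -h addrAC subrr add0r.
have [i0|i0] := leP 0 (im z).
  by exists (acos (re z)); rewrite /expi ca sa ger0_norm //; case: (z).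
exists (- acos (re z)); rewrite /expi cosN sinN ca sa ltr0_norm // opprK; by case: (z).
Qed.

Lemma polar (z : C) : exists t, z = `|z| * expi t.
Proof.
have [->|z0] := eqVneq z 0; first by exists 0; rewrite normr0 mul0r.
have [|t ht] := @expi_surj (z / `|z|).
  by rewrite normrM normfV normr_id divff ?normr_eq0.
by exists t; rewrite -ht mulrC divfK ?normr_eq0.
Qed.

Lemma re_gt0_dist1 (z : C) : `|z - 1| < 1 -> 0 < re z.
Proof.
rewrite norm_cabs ltcR => h.
have := le_lt_trans (re_le_cabs _) h; case: (z) => a b /=.
by rewrite ltr_norml => /andP[+ _]; rewrite ltrBrDr addNr.
Qed.

Lemma re_gt0_polar (z : C) : 0 < re z ->
  z = `|z| * expi (atan (im z / re z)).
Proof.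
case: z => a b /= a0; set t := b / a.
have s0 : 0 < Num.sqrt (1 + t ^+ 2) by rewrite sqrtr_gt0 ltr_pwDl // sqr_ge0.
have ca : cos (atan t) = (Num.sqrt (1 + t ^+ 2))^-1 by rewrite cos_atan.
have sa : sin (atan t) = t * (Num.sqrt (1 + t ^+ 2))^-1.
  have c0 : cos (atan t) != 0 by rewrite ca invr_eq0 gt_eqF.
  by rewrite -ca -[X in X * _](atanK t) /tan divfK.
have n : cabs (a +i* b)%C = a * Num.sqrt (1 + t ^+ 2).
  rewrite -[X in X * _]ger0_norm 1?ltW // -sqrtr_sqr -sqrtrM ?sqr_ge0 //=.
  by rewrite /cabs /= mulrDr mulr1 -exprMn [a * t]mulrC divfK // gt_eqF.
have a1 : a != 0 by rewrite gt_eqF.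
have s1 : Num.sqrt (1 + t ^+ 2) != 0 by rewrite gt_eqF.
rewrite norm_cabs n /expi ca sa; apply/eqP; rewrite eq_complex /=.
rewrite !mul0r subr0 addr0 mulfK // eqxx /=.
by rewrite mulrCA mulfK // /t divfK.
Qed.

End ComplexBasics.

(** * Winding number of a function along the unit circle *)

Section Winding.
Variable R : realType.
Local Notation C := (cplx R).
Local Notation re := (@complex.Re R).
Local Notation im := (@complex.Im R).
Implicit Types F G : C -> C.

Definition circle_cont F := continuous (fun t : R => F (expi t)).

(** [phi] is required on the whole line, where [F (expi t)] is periodic; this
    avoids continuity relative to a segment. *)
Definition has_wind F (n : int) := exists phi : R -> R,
  [/\ continuous phi, (forall t, F (expi t) = `|F (expi t)| * expi (phi t)) &
      phi (2 * pi) - phi 0 = 2 * pi * n%:~R].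

Lemma circle_contM F G : circle_cont F -> circle_cont G ->
  circle_cont (fun x => F x * G x).
Proof. by move=> hF hG t; apply: continuousM; [exact: hF|exact: hG]. Qed.

Lemma circle_contV F : circle_cont F -> (forall x, `|x| = 1 -> F x != 0) ->
  circle_cont (fun x => (F x)^-1).
Proof. by move=> hF F0 t; apply: continuousV; [exact: F0 (norm_expi t)|exact: hF]. Qed.

Lemma circle_cont_ext F G : (forall x, `|x| = 1 -> F x = G x) ->
  circle_cont F -> circle_cont G.
Proof.
move=> e; rewrite /circle_cont (_ : (fun t => F (expi t)) = (fun t => G (expi t))) //.
by apply/funext => t; apply: e; rewrite norm_expi.
Qed.

Lemma has_wind_ext F G n : (forall x, `|x| = 1 -> F x = G x) ->
  has_wind F n -> has_wind G n.
Proof.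
move=> e [phi [c h1 h2]]; exists phi; split=> // t.
by rewrite -e ?norm_expi.
Qed.

Lemma has_windM F G m n : has_wind F m -> has_wind G n ->
  has_wind (fun x => F x * G x) (m + n).
Proof.
move=> [f [cf f1 f2]] [g [cg g1 g2]]; exists (fun t => f t + g t); split.
- by move=> t; apply: continuousD; [exact: cf|exact: cg].
- by move=> t; rewrite {1}f1 {1}g1 normrM expiD mulrACA.
- by rewrite opprD addrACA f2 g2 -mulrDr -intrD.
Qed.

(** The values of [F] stay in the right half-plane, where the principal
    argument is continuous. *)
Lemma has_wind_near1 F : circle_cont F ->
  (forall x, `|x| = 1 -> `|F x - 1| < 1) -> has_wind F 0.
Proof.
move=> cF h; have p t : 0 < re (F (expi t)) by apply/re_gt0_dist1/h/norm_expi.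
exists (fun t => atan (im (F (expi t)) / re (F (expi t)))); split.
- move=> t; apply: continuous_comp; last exact: continuous_atan.
  apply: continuousM.
    by apply: (@continuous_comp _ _ _ (fun t => F (expi t)) im); [exact: cF|exact: continuous_im].
  apply: continuousV; first by rewrite gt_eqF.
  by apply: (@continuous_comp _ _ _ (fun t => F (expi t)) re); [exact: cF|exact: continuous_re].
- by move=> t; exact: re_gt0_polar.
- by rewrite expi2pi expi0 subrr mulr0.
Qed.

(** [F = G * (F / G)], and [F / G] stays within distance 1 of 1. *)
Lemma rouche F G n : circle_cont F -> circle_cont G ->
  (forall x, `|x| = 1 -> `|F x - G x| < `|G x|) ->
  has_wind G n -> has_wind F n.
Proof.
move=> cF cG h wG.
have G0 x : `|x| = 1 -> G x != 0.
  by move=> /h /(le_lt_trans (normr_ge0 _)); rewrite normr_gt0.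
rewrite -[n]addr0; apply: (@has_wind_ext (fun x => G x * (F x / G x))).
  by move=> x x1; rewrite mulrC divfK // G0.
apply: has_windM => //; apply: has_wind_near1.
  exact: (circle_contM cF (circle_contV cG G0)).
move=> x x1; rewrite -[X in _ - X](@divff _ (G x)) ?G0 // -mulrBl normrM normfV.
by rewrite ltr_pdivrMr ?normr_gt0 ?G0 // mul1r h.
Qed.

(** The difference of two continuous arguments is a continuous function with
    values in [2 pi Z].  If its total variation were a nonzero multiple of
    [2 pi], it would take a value at distance [pi] of the initial one. *)
Lemma has_wind_unique F m n : (forall x, `|x| = 1 -> F x != 0) ->
  has_wind F m -> has_wind F n -> m = n.
Proof.
move=> F0 [f [cf f1 f2]] [g [cg g1 g2]].
pose psi t := f t - g t.
have cpsi : continuous psi by move=> t; apply: continuousB; [exact: cf|exact: cg].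
have epsi t : expi (psi t) = 1.
  have n0 : `|F (expi t)| != 0 by rewrite normr_eq0 F0 ?norm_expi.
  have /(mulfI n0) e : `|F (expi t)| * expi (f t) = `|F (expi t)| * expi (g t).
    by rewrite -f1 -g1.
  by rewrite expiD expiN e divff ?expi_neq0.
have dpsi : psi (2 * pi) = psi 0 + 2 * pi * (m - n)%:~R.
  apply/eqP; rewrite addrC -subr_eq rmorphB /= mulrBr -f2 -g2 /psi; apply/eqP; ring.
have p0 : 0 < pi :> R by rewrite pi_gt0.
have ivt v : Num.min (psi 0) (psi (2 * pi)) <= v <= Num.max (psi 0) (psi (2 * pi)) ->
    expi v = 1.
  move=> hv; have le0 : 0 <= 2 * pi :> R by rewrite mulr_ge0 // ltW.
  have cw : {within `[0, 2 * pi], continuous psi} by exact: continuous_subspaceT.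
  by have [c _ <-] := IVT le0 cw hv; exact: epsi.
have nm1 : (1 : C) != - 1 by rewrite -subr_eq0 opprK -mulr2n pnatr_eq0.
apply/eqP; rewrite -subr_eq0; apply/negPn/negP => mn; apply/negP: nm1; apply/negPn/eqP.
have [k0|k0] := leP 0 (m - n).
  have k1 : 1 <= (m - n)%:~R :> R by rewrite ler1z; lia.
  have : expi (psi 0 + pi) = 1.
    apply: ivt; rewrite dpsi ge_min le_max !lerDl !lerD2l [0 <= pi]ltW //=.
    by apply/orP; right; nra.
  by rewrite expiD epsi expipi mul1r.
have k1 : (m - n)%:~R <= -1 :> R by rewrite -[-1]/((-1)%:~R) ler_int; lia.
have : expi (psi 0 - pi) = 1.
  apply: ivt; rewrite dpsi ge_min le_max !lerD2l !gerDl oppr_le0 [0 <= pi]ltW //= andbT.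
  by apply/orP; right; nra.
by rewrite expiD epsi expiN expipi mul1r invrN invr1.
Qed.

Lemma has_wind_cst (c : C) : has_wind (fun=> c) 0.
Proof.
have [t ht] := polar c; exists (fun=> t); split=> //; first exact: cst_continuous.
by rewrite subrr mulr0.
Qed.

Lemma has_wind_id : has_wind id 1.
Proof.
exists id; split; first by move=> t; exact: cvg_id.
  by move=> t; rewrite norm_expi mul1r.
by rewrite subr0 mulr1.
Qed.

Lemma continuous_poly (p : {poly C}) : continuous (fun x : C => p.[x]).
Proof.
elim/poly_ind: p => [|p c IH].
  by rewrite (_ : (fun x => _) = fun=> 0); [exact: cst_continuous|apply/funext => x; rewrite horner0].
rewrite (_ : (fun x => _) = (fun x : C => p.[x] * x) \+ (fun=> c)).
  move=> x; have h1 : {for x, continuous (fun x : C => p.[x] * x)}.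
    by apply: continuousM; [exact: IH|exact: cvg_id].
  exact: (continuousD h1 (@cst_continuous _ _ c x)).
by apply/funext => x; rewrite !hornerE.
Qed.

Lemma circle_cont_poly (p : {poly C}) : circle_cont (fun x => p.[x]).
Proof.
move=> t; apply: (@continuous_comp _ _ _ (@expi R) (fun x => p.[x])).
  exact: continuous_expi.
exact: continuous_poly.
Qed.

Lemma has_wind_exp F n k : has_wind F k -> has_wind (fun x => F x ^+ n) (k *+ n).
Proof.
move=> h; elim: n => [|n IH].
  by apply: has_wind_ext (has_wind_cst 1) => x _; rewrite expr0.
by rewrite mulrS; apply: has_wind_ext (has_windM h IH) => x _; rewrite exprS.
Qed.

Lemma has_wind_XsubC_in (k : C) : `|k| < 1 -> has_wind (fun x => x - k) 1.
Proof.
move=> k1; apply: rouche has_wind_id.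
- by have := @circle_cont_poly ('X - k%:P); apply: circle_cont_ext => x _; rewrite !hornerE.
- by have := @circle_cont_poly 'X; apply: circle_cont_ext => x _; rewrite !hornerE.
- by move=> x ->; rewrite addrAC subrr add0r normrN.
Qed.

Lemma has_wind_XsubC_out (k : C) : 1 < `|k| -> has_wind (fun x => x - k) 0.
Proof.
move=> k1; apply: (rouche _ _ _ (has_wind_cst (- k))).
- by have := @circle_cont_poly ('X - k%:P); apply: circle_cont_ext => x _; rewrite !hornerE.
- exact: cst_continuous.
- by move=> x x1; rewrite opprK subrK normrN x1.
Qed.

Lemma has_wind_poly (s : seq C) (c : C) : (forall k, k \in s -> `|k| != 1) ->
  has_wind (fun x => (c *: \prod_(k <- s) ('X - k%:P)).[x])
    (count (fun k => `|k| < 1) s).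
Proof.
elim: s => [|k s IH] h.
  by apply: has_wind_ext (has_wind_cst c) => x _; rewrite big_nil !hornerE.
have -> : (fun x => (c *: \prod_(k <- k :: s) ('X - k%:P)).[x]) =
  (fun x => (x - k) * (c *: \prod_(k <- s) ('X - k%:P)).[x]).
  by apply/funext => x; rewrite big_cons scalerAr !hornerM !hornerE.
rewrite /= PoszD; apply: has_windM; last first.
  by apply: IH => i si; apply: h; rewrite inE si orbT.
have /h : k \in k :: s by rewrite mem_head.
have [k1 _|] := boolP (`|k| < 1); first exact: has_wind_XsubC_in.
rewrite -real_leNgt ?realE ?normr_ge0 ?ler01 // => h1 h2.
by apply: has_wind_XsubC_out; rewrite lt_neqAle eq_sym h2.
Qed.

End Winding.

(** * Compactness of the closed unit disc *)

Section ClosedDisc.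
Variable R : realType.
Local Notation C := (cplx R).
Local Notation re := (@complex.Re R).
Local Notation im := (@complex.Im R).
Implicit Types f : C -> C.

Lemma real_gt0 (d : R) : 0 < d -> (0 : C) < d%:C%C.
Proof. by rewrite ltcR. Qed.

Lemma norm_le1 (w : C) : (`|w| <= 1) = (cabs w <= 1).
Proof. by rewrite norm_cabs (_ : (1 : C) = 1%:C%C) ?lecR. Qed.

Lemma compact_disc : compact [set w : C | `|w| <= 1].
Proof.
pose sq := (fun p : R * R => (p.1 +i* p.2)%C : C) @` (`[-1, 1] `*` `[-1, 1]).
have csq : compact sq.
  apply: continuous_compact; last by apply: compact_setX; exact: segment_compact.
  apply: continuous_subspaceT => p; apply: continuous_cplx; [exact: cvg_fst|exact: cvg_snd].
apply: subclosed_compact csq _.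
  rewrite (_ : [set w | _] = (fun w : C => re `|w|) @^-1` [set x | x <= 1]).
    apply: closed_comp; last exact: closed_le.
    move=> x _; apply: (@continuous_comp _ _ _ (fun w : C => `|w|) re).
      exact: norm_continuous.
    exact: continuous_re.
  have renorm (w : C) : re `|w| = cabs w by rewrite norm_cabs.
  apply/funext => w; apply/propext; change (`|w| <= 1 <-> re `|w| <= 1).
  by rewrite renorm norm_le1.
move=> w /=; rewrite norm_le1 => w1.
exists (re w, im w) => /=; last by case: (w).
split; rewrite /= in_itv /= -ler_norml; apply: le_trans w1.
  exact: re_le_cabs.
exact: im_le_cabs.
Qed.

(** Lebesgue number principle: a property of a point and of a radius that holds
    locally for all small radii holds for a radius common to the whole disc. *)
Lemma disc_near (P : R -> C -> Prop) :
  (forall w : C, `|w| <= 1 -> exists2 d : R, 0 < d & forall w', `|w'| <= 1 ->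
     `|w' - w| < d%:C%C -> forall r : R, 0 < r -> r < d -> P r w') ->
  exists2 r : R, 0 < r & forall w : C, `|w| <= 1 -> P r w.
Proof.
move=> H; have /compact_near_coveringP cov := compact_disc.
pose Q r (w : C) := `|w| <= 1 -> P r w.
have [] : \forall r \near (0 : R)^'+, [set w : C | `|w| <= 1] `<=` Q r.
  apply: (cov R (0^'+) Q _) => w /= /H [d d0 hd].
  exists ([set w' : C | `|w' - w| < d%:C%C], [set r | 0 < r < d]).
    split => /=; first by apply/nearP; exists d%:C%C; rewrite ?real_gt0.
    near=> r; apply/andP; split; near: r; [exact: nbhs_right_gt|exact: nbhs_right_lt].
  by move=> [w' r] /= [h1 /andP[r0 rd]] w'1; apply: hd.
move=> r r0 hr; have r2 : 0 < r / 2 by rewrite divr_gt0.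
exists (r / 2) => // w w1; apply: (hr _ _ r2) => //=.
by rewrite sub0r normrN gtr0_norm // gtr_pMr // invf_lt1 // ltr1n.
Unshelve. all: by end_near. Qed.

Definition disc_cont f := forall w : C, `|w| <= 1 -> forall e : C, 0 < e ->
  exists2 d : C, 0 < d & forall w', `|w'| <= 1 -> `|w' - w| < d -> `|f w' - f w| < e.

Lemma disc_cont_unif f : disc_cont f -> forall e : C, 0 < e ->
  exists2 d : C, 0 < d & forall w w', `|w| <= 1 -> `|w'| <= 1 ->
    `|w' - w| < d -> `|f w' - f w| < e.
Proof.
move=> cf e e0; have e2 : 0 < e / 2 by rewrite divr_gt0.
have [|r r0 hr] := @disc_near (fun r w => forall w', `|w'| <= 1 ->
    `|w' - w| < r%:C%C -> `|f w' - f w| < e).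
  move=> w w1; have [d d0 hd] := cf w w1 _ e2.
  have [ed rd0] := gt0_re d0.
  exists (re d / 2); first by rewrite divr_gt0.
  move=> w' w'1 ww' r r0 rd w'' w''1 w2.
  rewrite (splitr e) -[X in `|X|](subrKA (f w)) (le_lt_trans (ler_normD _ _)) //.
  rewrite ltrD ?(distrC (f w)) ?hd //.
    rewrite -(subrKA w') (le_lt_trans (ler_normD _ _)) // ed (splitr (re d)) rmorphD.
    by rewrite ltrD // (lt_trans w2) // ltcR.
  by rewrite (lt_trans ww') // ed ltcR gtr_pMr // invf_lt1 // ltr1n.
by exists r%:C%C; [exact: real_gt0|move=> w w' w1 w'1; exact: hr].
Qed.

(** The condition on [A] says that the closure of [A] contains no zero of [f]
    in the disc; it is applied to the whole disc and to the unit circle. *)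
Lemma disc_cont_min f (A : C -> Prop) : disc_cont f ->
  (forall w, `|w| <= 1 -> f w = 0 -> exists2 d : C, 0 < d &
     forall w', `|w' - w| < d -> ~ A w') ->
  exists2 m : C, 0 < m & forall w, `|w| <= 1 -> A w -> m <= `|f w|.
Proof.
move=> cf hA.
have [|r r0 hr] := @disc_near (fun r w => A w -> r%:C%C <= `|f w|); last first.
  by exists r%:C%C; [exact: real_gt0|exact: hr].
move=> w w1; have [fw0|fw0] := eqVneq (f w) 0.
  have [d d0 hd] := hA w w1 fw0; have [ed rd0] := gt0_re d0.
  by exists (re d) => // w' _; rewrite -ed => /hd.
have e0 : 0 < `|f w| / 2 by rewrite divr_gt0 // normr_gt0.
have [d d0 hd] := cf w w1 _ e0.
have [ed rd0] := gt0_re d0; have [ee re0] := gt0_re e0.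
exists (Num.min (re d) (re (`|f w| / 2))); first by rewrite lt_min rd0.
move=> w' w'1 h r r0; rewrite lt_min => /andP[_ rf] _.
have /(hd _ w'1) h2 : `|w' - w| < d.
  by rewrite ed (lt_le_trans h) // lecR ge_min lexx.
have h3 : `|f w| - `|f w' - f w| <= `|f w'|.
  by rewrite lerBlDr distrC -{1}(subrK (f w') (f w)) addrC ler_normD.
apply: le_trans h3; rewrite lerBrDr (splitr `|f w|) lerD // ?ltW //.
by rewrite ee ltcR.
Qed.

Lemma disc_cont_circle f (c : C) : disc_cont f -> `|c| <= 1 ->
  circle_cont (fun x => f (x * c)).
Proof.
move=> cf c1 t; have h s : `|expi s * c| <= 1 by rewrite normrM norm_expi mul1r.
apply/cvgrPdist_lt => e e0; have [d d0 hd] := cf _ (h t) _ e0.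
have /cvgrPdist_lt /(_ _ d0) ct := @continuous_expi R t.
near=> s.
rewrite distrC; apply: hd => //.
rewrite -mulrBl normrM (le_lt_trans (ler_piMr _ c1)) // distrC.
by near: s.
Unshelve. all: by end_near. Qed.

(** The dilations [x |-> f (c x)], for [c] from 0 to 1, deform [f] into a
    constant.  By uniform continuity finitely many of them suffice, each being
    close enough to the preceding one for Rouché's theorem. *)
Lemma has_wind_nonvanishing f : disc_cont f ->
  (forall w, `|w| <= 1 -> f w != 0) -> has_wind f 0.
Proof.
move=> cf f0; have [|m m0 hm] := @disc_cont_min f (fun=> True) cf.
  by move=> w /f0 /eqP.
have [d d0 hd] := disc_cont_unif cf m0; have [ed rd0] := gt0_re d0.
have [N hN] : exists N : nat, (N.+1%:R)^-1 < re d.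
  by have [N hN] := @ltr_add_invr R 0 (re d) rd0; exists N; rewrite add0r in hN.
pose g k (x : C) := f (x * (k%:R / N.+1%:R)).
have c1 k : (k <= N.+1)%N -> `|k%:R / N.+1%:R : C| <= 1.
  by move=> kN; rewrite normf_div !normr_nat ler_pdivrMr ?ltr0n // mul1r ler_nat.
suff : has_wind (g N.+1) 0.
  by apply: has_wind_ext => x _; rewrite /g divff ?mulr1 // pnatr_eq0.
have : (N.+1 <= N.+1)%N by [].
elim: {1 3}N.+1 => [|k IH] kN.
  by apply: has_wind_ext (has_wind_cst (f 0)) => x _; rewrite /g mul0r mulr0.
apply: rouche (IH (ltnW kN)); try by apply: disc_cont_circle => //; apply: c1 => //; exact: ltnW.
move=> x x1; have hx j : (j <= N.+1)%N -> `|x * (j%:R / N.+1%:R)| <= 1.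
  by move=> /c1 h; rewrite normrM x1 mul1r.
have kN' := ltnW kN.
apply: lt_le_trans (hm _ (hx k kN') I); apply: hd; rewrite ?hx //.
rewrite -mulrBr normrM x1 mul1r -mulrBl -natrB // subSnn mul1r ger0_norm ?invr_ge0 //.
by rewrite ed -(rmorph_nat (real_complex R)) -fmorphV ltcR.
Qed.

End ClosedDisc.

(** * The disc algebra *)

Section DiscAlgebra.
Variable R : realType.
Local Notation C := (cplx R).
Local Notation re := (@complex.Re R).
Local Notation im := (@complex.Im R).
Implicit Types f g h : C -> C.

Lemma small_inv (e : C) : 0 < e -> exists N : nat, forall n, (N <= n)%N -> n.+1%:R^-1 < e.
Proof.
move=> e0; have [ee re0] := gt0_re e0.
have [N hN] := @ltr_add_invr R 0 (re e) re0; rewrite add0r in hN.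
exists N => n Nn; apply: (@le_lt_trans _ _ N.+1%:R^-1).
  by rewrite lef_pV2 ?posrE ?ltr0n // ler_nat.
by rewrite ee -(rmorph_nat (real_complex R)) -fmorphV ltcR.
Qed.

Lemma small_exp (b e : C) : 0 <= b -> b < 1 -> 0 < e ->
  exists N : nat, forall n, (N <= n)%N -> b ^+ n < e.
Proof.
move=> b0 b1 e0; have [ee re0] := gt0_re e0.
have eb : b = (re b)%:C%C by rewrite RRe_real // realE b0.
have b0' : 0 <= re b by rewrite -ler0c -eb.
have b1' : `|re b| < 1 by rewrite ger0_norm // -ltcR -eb.
have /cvgrPdist_lt /(_ _ re0) [N _ hN] := cvg_expr b1'.
exists N => n Nn; have := hN n Nn.
by rewrite sub0r normrN ger0_norm ?exprn_ge0 // -ltcR rmorphXn /= -eb -ee.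
Qed.

Lemma all_small_eq0 (x : C) : (forall e, 0 < e -> `|x| <= e) -> x = 0.
Proof.
move=> h; apply/eqP; rewrite -normr_eq0; apply/negPn/negP => x0.
have xp : 0 < `|x| by rewrite lt_neqAle eq_sym x0 normr_ge0.
have := h (`|x| / 2) (divr_gt0 xp (ltr0n _ 2)).
by rewrite ler_pMr // invf_ge1 ?ltr0n // (ler_nat _ 2 1).
Qed.

Lemma cauchy_cplx (u : nat -> C) :
  (forall e : C, 0 < e -> exists N, forall n m, (N <= n)%N -> (N <= m)%N -> `|u n - u m| < e) ->
  exists L, forall e : C, 0 < e -> exists N, forall n, (N <= n)%N -> `|u n - L| < e.
Proof.
move=> cu.
have conv (p : C -> R) : (forall x y, `|p x - p y| <= cabs (x - y)) ->
    cvg (p (u n) @[n --> \oo]).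
  move=> hp; apply/cauchy_cvgP/cauchyP => e e0.
  have [N hN] := cu _ (real_gt0 e0).
  exists (p (u N)); exists N => // n /= Nn.
  rewrite /ball /= (le_lt_trans (hp _ _)) // -ltcR -norm_cabs; exact: hN.
have /conv /cvgrPdist_lt cre : forall x y, `|re x - re y| <= cabs (x - y).
  by move=> [a b] [c d]; exact: re_le_cabs ((a +i* b)%C - (c +i* d)%C).
have /conv /cvgrPdist_lt cim : forall x y, `|im x - im y| <= cabs (x - y).
  by move=> [a b] [c d]; exact: im_le_cabs ((a +i* b)%C - (c +i* d)%C).
set a := lim _ in cre; set b := lim _ in cim.
exists (a +i* b)%C => e e0; have [ee re0] := gt0_re e0.
have e2 : 0 < re e / 2 by rewrite divr_gt0.
have [N1 _ h1] := cre _ e2; have [N2 _ h2] := cim _ e2.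
exists (maxn N1 N2) => n; rewrite geq_max => /andP[n1 n2].
rewrite distrC ee norm_cabs ltcR (le_lt_trans (cabs_le _)) // (splitr (re e)).
have := h1 n n1; have := h2 n n2; case: (u n) => x y /= ? ?; exact: ltrD.
Qed.

Definition disc_alg f := forall e : C, 0 < e ->
  exists q : {poly C}, forall w, `|w| <= 1 -> `|f w - q.[w]| < e.

Lemma disc_alg_ext f g : (forall w, `|w| <= 1 -> f w = g w) -> disc_alg f -> disc_alg g.
Proof. by move=> e h x /h[q hq]; exists q => w w1; rewrite -e // hq. Qed.

Lemma disc_alg_lim f : (forall e, 0 < e -> exists2 g, disc_alg g &
  forall w, `|w| <= 1 -> `|f w - g w| < e) -> disc_alg f.
Proof.
move=> h e e0; have e2 : 0 < e / 2 by rewrite divr_gt0.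
have [g /(_ _ e2)[q hq] hg] := h _ e2; exists q => w w1.
rewrite -(subrKA (g w)) (splitr e) (le_lt_trans (ler_normD _ _)) //.
by rewrite ltrD ?hg ?hq.
Qed.

Lemma disc_alg_poly (q : {poly C}) : disc_alg (fun w => q.[w]).
Proof. by move=> e e0; exists q => w _; rewrite subrr normr0. Qed.

Lemma disc_alg_cst c : disc_alg (fun=> c).
Proof. by apply: disc_alg_ext (disc_alg_poly c%:P) => w _; rewrite hornerC. Qed.

Lemma disc_alg_id : disc_alg id.
Proof. by apply: disc_alg_ext (disc_alg_poly 'X) => w _; rewrite hornerX. Qed.

Lemma poly_bound (q : {poly C}) : exists2 M : C, 0 < M & forall w, `|w| <= 1 -> `|q.[w]| <= M.
Proof.
elim/poly_ind: q => [|q c [M M0 hM]].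
  by exists 1 => // w _; rewrite horner0 normr0 ler01.
exists (M + `|c|); first by rewrite ltr_pwDl.
move=> w w1; rewrite hornerMXaddC (le_trans (ler_normD _ _)) // lerD2r normrM.
by rewrite (le_trans (ler_piMr _ w1)) ?hM.
Qed.

Lemma disc_alg_bound f : disc_alg f -> exists2 M : C, 0 < M & forall w, `|w| <= 1 -> `|f w| <= M.
Proof.
move=> /(_ 1 ltr01)[q hq]; have [M M0 hM] := poly_bound q.
exists (1 + M); first by rewrite addr_gt0.
move=> w w1; rewrite -(subrK q.[w] (f w)) (le_trans (ler_normD _ _)) //.
by rewrite lerD ?hM // ltW // hq.
Qed.

Lemma disc_algD f g : disc_alg f -> disc_alg g -> disc_alg (fun w => f w + g w).
Proof.
move=> hf hg e e0; have e2 : 0 < e / 2 by rewrite divr_gt0.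
have [q hq] := hf _ e2; have [r hr] := hg _ e2; exists (q + r) => w w1.
rewrite hornerD opprD addrACA (splitr e) (le_lt_trans (ler_normD _ _)) //.
by rewrite ltrD ?hq ?hr.
Qed.

Lemma disc_algM f g : disc_alg f -> disc_alg g -> disc_alg (fun w => f w * g w).
Proof.
move=> hf hg e e0; have e2 : 0 < e / 2 by rewrite divr_gt0.
have [M M0 hM] := disc_alg_bound hf.
have [r hr] := hg _ (divr_gt0 e2 M0); have [K K0 hK] := poly_bound r.
have [q hq] := hf _ (divr_gt0 e2 K0); exists (q * r) => w w1.
have -> : f w * g w - (q * r).[w] = (f w - q.[w]) * r.[w] + f w * (g w - r.[w]).
  by rewrite hornerM; ring.
rewrite (splitr e) (le_lt_trans (ler_normD _ _)) // !normrM.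
apply: ltr_leD.
  by rewrite (le_lt_trans (ler_wpM2l _ (hK w w1))) // -ltr_pdivlMr // hq.
by rewrite (le_trans (ler_wpM2r _ (hM w w1))) // mulrC -ler_pdivlMr // ltW // hr.
Qed.

Lemma disc_algN f : disc_alg f -> disc_alg (fun w => - f w).
Proof.
by move=> /(disc_algM (disc_alg_cst (-1))); apply: disc_alg_ext => w _; rewrite mulN1r.
Qed.

Lemma disc_algB f g : disc_alg f -> disc_alg g -> disc_alg (fun w => f w - g w).
Proof. by move=> hf /disc_algN; exact: disc_algD. Qed.

Lemma disc_alg_sum (I : Type) (s : seq I) (P : pred I) (F : I -> C -> C) :
  (forall i, P i -> disc_alg (F i)) -> disc_alg (fun w => \sum_(i <- s | P i) F i w).
Proof.
move=> h; elim: s => [|i s IH].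
  by apply: disc_alg_ext (disc_alg_cst 0) => w _; rewrite big_nil.
case Pi: (P i); last by apply: disc_alg_ext IH => w _; rewrite big_cons Pi.
by apply: disc_alg_ext (disc_algD (h i Pi) IH) => w _; rewrite big_cons Pi.
Qed.

Lemma disc_alg_prod (I : Type) (s : seq I) (P : pred I) (F : I -> C -> C) :
  (forall i, P i -> disc_alg (F i)) -> disc_alg (fun w => \prod_(i <- s | P i) F i w).
Proof.
move=> h; elim: s => [|i s IH].
  by apply: disc_alg_ext (disc_alg_cst 1) => w _; rewrite big_nil.
case Pi: (P i); last by apply: disc_alg_ext IH => w _; rewrite big_cons Pi.
by apply: disc_alg_ext (disc_algM (h i Pi) IH) => w _; rewrite big_cons Pi.
Qed.

Lemma disc_algX f n : disc_alg f -> disc_alg (fun w => f w ^+ n).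
Proof.
move=> hf; elim: n => [|n IH]; first by apply: disc_alg_ext (disc_alg_cst 1) => w _; rewrite expr0.
by apply: disc_alg_ext (disc_algM hf IH) => w _; rewrite exprS.
Qed.

Lemma disc_alg_det n (A : 'I_n -> 'I_n -> C -> C) : (forall i j, disc_alg (A i j)) ->
  disc_alg (fun w => \det (\matrix_(i, j) A i j w)).
Proof.
move=> hA; rewrite /determinant; apply: disc_alg_sum => s _.
apply: disc_algM; first exact: disc_alg_cst.
by apply: disc_alg_prod => i _; apply: disc_alg_ext (hA i _) => w _; rewrite mxE.
Qed.

Lemma disc_alg_cont f : disc_alg f -> disc_cont f.
Proof.
move=> hf w w1 e e0; have e3 : 0 < e / 3%:R by rewrite divr_gt0 // ltr0n.
have [q hq] := hf _ e3.
have /cvgrPdist_lt /(_ _ e3) /nearP [d d0 hd] := @continuous_poly R q w.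
exists d => // w' w'1 /hd; rewrite distrC => h.
have -> : f w' - f w = (f w' - q.[w']) + (q.[w'] - q.[w]) - (f w - q.[w]) by ring.
have -> : e = e / 3%:R + e / 3%:R + e / 3%:R by field.
by rewrite (le_lt_trans (ler_normB _ _)) // ltrD ?hq // (le_lt_trans (ler_normD _ _)) // ltrD ?hq.
Qed.

Lemma disc_alg_geom (b : C) : `|b| < 1 -> disc_alg (fun w => (1 - b * w)^-1).
Proof.
move=> b1 e e0; have b0 : 0 < 1 - `|b| by rewrite subr_gt0.
have [N hN] := small_exp (normr_ge0 b) b1 (mulr_gt0 e0 b0).
exists (\sum_(i < N) b ^+ i *: 'X^i) => w w1.
have lb : 1 - `|b| <= `|1 - b * w|.
  rewrite (le_trans _ (lerB_dist _ _)) // normr1 lerD2l lerN2 normrM.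
  exact: ler_piMr.
have n0 : 1 - b * w != 0 by rewrite -normr_gt0 (lt_le_trans b0).
have -> : (\sum_(i < N) b ^+ i *: 'X^i).[w] = (1 - (b * w) ^+ N) / (1 - b * w).
  apply: (mulfI n0); rewrite mulrCA divff // mulr1 -[in RHS](expr1n _ N) subrXX.
  congr (_ * _); rewrite horner_sum; apply: eq_bigr => i _.
  by rewrite !hornerE expr1n mul1r exprMn.
have -> : (1 - b * w)^-1 - (1 - (b * w) ^+ N) / (1 - b * w) = (b * w) ^+ N / (1 - b * w) by field.
rewrite normrM normfV ltr_pdivrMr ?(lt_le_trans b0) //.
have h1 : `|(b * w) ^+ N| <= `|b| ^+ N.
  by rewrite normrX normrM lerXn2r ?nnegrE ?mulr_ge0 // ler_piMr.
rewrite (le_lt_trans h1) // (lt_le_trans (hN N (leqnn _))) //.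
by rewrite ler_pM2l.
Qed.

End DiscAlgebra.

(** * The maximum principle and the argument principle *)

Section ArgumentPrinciple.
Variable R : realType.
Local Notation C := (cplx R).
Implicit Types f g h : C -> C.

Lemma ltr1_norm (w : C) : `|w| <= 1 -> `|w| != 1 -> `|w| < 1.
Proof. by move=> a b; rewrite lt_neqAle b a. Qed.

Lemma poly_wind (q : {poly C}) : (forall x, `|x| = 1 -> q.[x] != 0) ->
  has_wind (fun x => q.[x]) (count (fun k => `|k| < 1) (sval (closed_field_poly_normal q))).
Proof.
case: closed_field_poly_normal => s /= hs q0; rewrite [in X in has_wind X]hs.
apply: has_wind_poly => k ks; apply/negP => /eqP k1; have := q0 k k1.
by rewrite hs hornerZ (_ : _.[k] = 0) ?mulr0 ?eqxx //; apply/eqP; rewrite -/(root _ k) root_prod_XsubC.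
Qed.

(** If [|q v|] exceeded the values of [|q|] on the circle, then [q - q v] would
    have the winding number of the constant [- q v], namely 0, though it has
    the zero [v] in the disc. *)
Lemma max_principle (q : {poly C}) M : 0 <= M ->
  (forall x, `|x| = 1 -> `|q.[x]| <= M) -> forall v, `|v| <= 1 -> `|q.[v]| <= M.
Proof.
move=> M0 hM v v1; rewrite real_leNgt ?realE ?normr_ge0 ?M0 //; apply/negP => hv.
have [/hM|v1'] := eqVneq `|v| 1; first by move=> /(lt_le_trans hv); rewrite ltxx.
pose P := q - q.[v]%:P.
have dist x : `|x| = 1 -> `|P.[x] - (- q.[v])| < `|- q.[v]|.
  by move=> /hM h; rewrite /P !hornerE opprK subrK normrN (le_lt_trans h).
have P0 x : `|x| = 1 -> P.[x] != 0.
  move=> /dist; apply: contraTneq => ->; rewrite sub0r opprK normrN ltxx //.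
have w0 : has_wind (fun x => P.[x]) 0.
  apply: (rouche _ _ dist (has_wind_cst _)); first exact: circle_cont_poly.
  exact: cst_continuous.
have := has_wind_unique P0 w0 (poly_wind P0).
case: closed_field_poly_normal => s /= hs /esym /eqP.
rewrite eqz_nat eqn0Ngt -has_count => /hasP; apply.
exists v; last exact: ltr1_norm.
have Pn : P != 0 by apply/eqP => e; have := P0 1 (normr1 _); rewrite e horner0 eqxx.
have : root P v by rewrite /root /P !hornerE subrr.
by rewrite hs rootZ ?lead_coef_eq0 // root_prod_XsubC.
Qed.

Lemma disc_alg_complete (u : nat -> {poly C}) :
  (forall e : C, 0 < e -> exists N, forall n m w, (N <= n)%N -> (N <= m)%N -> `|w| <= 1 ->
     `|(u n).[w] - (u m).[w]| < e) ->
  exists2 g, disc_alg g & forall w, `|w| <= 1 -> forall e, 0 < e ->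
    exists N, forall n, (N <= n)%N -> `|(u n).[w] - g w| < e.
Proof.
move=> cu.
have /choice[g hg] : forall w : C, exists L : C, `|w| <= 1 -> forall e, 0 < e ->
    exists N, forall n, (N <= n)%N -> `|(u n).[w] - L| < e.
  move=> w; have [w1|w1] := boolP (`|w| <= 1); last by exists 0.
  have [e e0|L hL] := @cauchy_cplx R (fun n => (u n).[w]); last by exists L.
  by have [N hN] := cu e e0; exists N => n m Nn Nm; exact: hN.
exists g => // e e0; have e2 : 0 < e / 2 by rewrite divr_gt0.
have [N hN] := cu _ e2; exists (u N) => w w1.
have [N' hN'] := hg w w1 _ e2; pose m := maxn N N'.
rewrite (splitr e) distrC -(subrKA (u m).[w]) (le_lt_trans (ler_normD _ _)) //.
by rewrite ltrD ?hN ?hN' ?leq_maxl ?leq_maxr.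
Qed.

(** The difference quotients at [w0] of polynomials approaching [f] are
    polynomials, and on the circle they form a uniform Cauchy sequence because
    [w0] is at a positive distance from it.  The maximum principle extends this
    to the disc, including the point [w0] itself. *)
Lemma disc_alg_div f w0 : disc_alg f -> `|w0| < 1 ->
  exists2 g, disc_alg g & forall w, `|w| <= 1 -> f w = f w0 + (w - w0) * g w.
Proof.
move=> hf w01.
have /choice[q hq] : forall n : nat, exists q : {poly C}, forall w, `|w| <= 1 -> `|f w - q.[w]| < n.+1%:R^-1.
  by move=> n; apply: hf; rewrite invr_gt0 ltr0n.
have /choice[h hh] : forall n : nat, exists h : {poly C}, q n - (q n).[w0]%:P = h * ('X - w0%:P).
  by move=> n; apply/factor_theorem; rewrite /root !hornerE subrr.
have w01' := ltW w01.
pose d := 1 - `|w0|; have d0 : 0 < d by rewrite subr_gt0.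
have hE n w : (w - w0) * (h n).[w] = (q n).[w] - (q n).[w0].
  by have := congr1 (fun p => p.[w]) (hh n); rewrite !hornerE => ->; rewrite mulrC.
have qq n m w : `|w| <= 1 -> `|(q n).[w] - (q m).[w]| <= n.+1%:R^-1 + m.+1%:R^-1.
  move=> w1; rewrite distrC -(subrKA (f w)) addrC (le_trans (ler_normD _ _)) //.
  by rewrite lerD // ?(distrC _ (f w)) ltW // hq.
have hb n m w : `|w| <= 1 -> `|(h n).[w] - (h m).[w]| <= (n.+1%:R^-1 + m.+1%:R^-1) *+ 2 / d.
  move=> w1; have -> : (h n).[w] - (h m).[w] = (h n - h m).[w] by rewrite !hornerE.
  apply: max_principle w1 => [|x x1].
    by rewrite divr_ge0 ?ltW // mulrn_wge0 // addr_ge0 // invr_ge0.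
  have dx : d <= `|x - w0| by rewrite /d -x1 lerB_dist.
  rewrite ler_pdivlMr // (le_trans (ler_wpM2l _ dx)) // -normrM.
  have -> : (h n - h m).[x] * (x - w0) = ((q n).[x] - (q m).[x]) - ((q n).[w0] - (q m).[w0]).
    by rewrite !hornerE mulrC mulrBr !hE; ring.
  by rewrite mulr2n (le_trans (ler_normB _ _)) // lerD // qq // x1.
have [|g hg gh] := @disc_alg_complete h.
  move=> e e0; have /small_inv[N hN] : 0 < e * d / 4%:R by rewrite divr_gt0 ?mulr_gt0 // ltr0n.
  exists N => n m w Nn Nm w1; rewrite (le_lt_trans (hb n m w w1)) //.
  rewrite ltr_pdivrMr // (_ : e * d = (e * d / 4%:R + e * d / 4%:R) *+ 2); last by field.
  by rewrite ltrMn2r /= ltrD ?hN.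
exists g => // w w1; apply/eqP; rewrite -subr_eq0; apply/eqP/all_small_eq0 => e e0.
have e4 : 0 < e / 4%:R by rewrite divr_gt0 // ltr0n.
have [N1 h1] := gh w w1 _ e4; have [N2 h2] := small_inv e4.
pose n := maxn N1 N2.
have -> : f w - (f w0 + (w - w0) * g w) = (f w - (q n).[w]) - (f w0 - (q n).[w0]) +
   (w - w0) * ((h n).[w] - g w) by rewrite mulrBr hE; ring.
have -> : e = e / 4%:R + e / 4%:R + (1 + 1) * (e / 4%:R) by field.
rewrite (le_trans (ler_normD _ _)) // lerD //.
  rewrite (le_trans (ler_normB _ _)) // lerD // ltW // (lt_trans (hq n _ _)) // h2 ?leq_maxr //.
rewrite normrM ler_pM //; last by rewrite ltW // h1 ?leq_maxl.
by rewrite (le_trans (ler_normB _ _)) // lerD.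
Qed.

(** The winding number is that of a polynomial close to [f], whence it is a
    natural number. *)
Lemma disc_alg_wind f : disc_alg f -> (forall x, `|x| = 1 -> f x != 0) ->
  exists n : nat, has_wind f n.
Proof.
move=> hf f0; have cf := disc_alg_cont hf.
have [|m m0 hm] := @disc_cont_min R f (fun w => `|w| = 1) cf.
  move=> w w1 fw; have w1' : `|w| < 1.
    by apply: ltr1_norm => //; apply: contra_eq_neq fw => /f0.
  exists (1 - `|w|); rewrite ?subr_gt0 // => w' h w'1.
  have : `|w'| < 1.
    by rewrite -(subrK w w') (le_lt_trans (ler_normD _ _)) // -ltrBrDr.
  by rewrite w'1 ltxx.
have m2 : 0 < m / 2 by rewrite divr_gt0.
have [q hq] := hf _ m2.
have qm x : `|x| = 1 -> m / 2 <= `|q.[x]|.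
  move=> x1; have x1' : `|x| <= 1 by rewrite x1.
  have := ler_normD (f x - q.[x]) q.[x]; rewrite subrK => /(le_trans (hm x x1' x1)) h.
  rewrite -(lerD2l (m / 2)) -splitr (le_trans h) //.
  by rewrite lerD2r ltW // hq.
exists (count (fun k => `|k| < 1) (sval (closed_field_poly_normal q))).
apply: (@rouche _ f (fun x => q.[x])).
- have := @disc_cont_circle R f 1 cf; rewrite normr1 lexx => /(_ isT).
  by apply: circle_cont_ext => x _; rewrite mulr1.
- exact: circle_cont_poly.
- by move=> x x1; rewrite (lt_le_trans (hq _ _)) ?qm ?x1.
- by apply: poly_wind => x /qm; rewrite -normr_gt0; exact: lt_le_trans.
Qed.

(** Induction on the winding number: dividing out a zero lowers it by 1, and
    without zeros it vanishes. *)
Theorem argument_principle f : disc_alg f -> (forall x, `|x| = 1 -> f x != 0) ->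
  exists (zs : seq C) (h : C -> C),
    [/\ (forall x, x \in zs -> `|x| < 1), disc_alg h,
        (forall w, `|w| <= 1 -> h w != 0),
        (forall w, `|w| <= 1 -> f w = \prod_(x <- zs) (w - x) * h w) &
        has_wind f (size zs)].
Proof.
move=> hf f0; have [n hn] := disc_alg_wind hf f0.
elim/ltn_ind: n f hf f0 hn => n IH f hf f0 hn.
have [[w0 w01 fw0]|nz] := pselect (exists2 w, `|w| <= 1 & f w = 0); last first.
  have {}nz w : `|w| <= 1 -> f w != 0 by move=> w1; apply/eqP => fw; apply: nz; exists w.
  exists [::], f; split => //; first by move=> w _; rewrite big_nil mul1r.
  by apply: has_wind_nonvanishing => //; exact: disc_alg_cont.
have {}w01 : `|w0| < 1.
  by apply: ltr1_norm => //; apply: contra_eq_neq fw0 => /f0.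
have [g hg fg] := disc_alg_div hf w01; rewrite fw0 in fg.
have {}fg w : `|w| <= 1 -> f w = (w - w0) * g w by move=> /fg ->; rewrite add0r.
have g0 x : `|x| = 1 -> g x != 0.
  move=> x1; have := f0 x x1; rewrite fg ?x1 // mulf_eq0 negb_or; by case/andP.
have [k hk] := disc_alg_wind hg g0.
have wf j : has_wind g j -> has_wind f (1 + j).
  move=> /(has_windM (has_wind_XsubC_in w01)); apply: has_wind_ext => x x1.
  by rewrite fg ?x1.
have nk : n = k.+1.
  apply/eqP; rewrite -eqz_nat -addn1 PoszD addrC; apply/eqP.
  exact: has_wind_unique f0 hn (wf _ hk).
have [|zs [h [zs1 hh h0 gh wg]]] := IH k _ g hg g0 hk; first by rewrite nk.
exists (w0 :: zs), h; split => //.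
- by move=> x; rewrite inE => /predU1P[->//|/zs1].
- by move=> w w1; rewrite big_cons fg // gh // mulrA.
- by rewrite /= -add1n PoszD; exact: wf.
Qed.
End ArgumentPrinciple.

(** * Trapezoidal sums over the roots of unity *)

Section RootsOfUnity.
Variable R : realType.
Local Notation C := (cplx R).

Lemma unity_root_exists N : (0 < N)%N -> exists z : C,
  forall n, (z ^+ n == 1) = (N %| n)%N.
Proof.
move=> N0; pose t : R := pi / N%:R; exists (expi (t + t)) => n.
have N0' : N%:R != 0 :> R by rewrite pnatr_eq0 -lt0n.
have zN : expi (t + t) ^+ N = 1 :> C.
  by rewrite -expi_muln mulrDr /t mulrCA divff // mulr1 -mulr2n -mulr_natl expi2pi.
rewrite {1}(divn_eq n N) exprD mulnC exprM zN expr1n mul1r.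
rewrite -expi_muln /dvdn; set k := (n %% N)%N.
have kN : (k < N)%N by rewrite ltn_mod.
case: posnP => [->|k0]; first by rewrite mul0r expi0 !eqxx.
apply/negbTE/eqP => /(congr1 (@complex.Re R)) /=; rewrite mulrDr cosD -!expr2.
set s := k%:R * t; have sp : 0 < s < pi.
  rewrite mulr_gt0 ?divr_gt0 ?pi_gt0 ?ltr0n //= /s /t mulrCA gtr_pMr ?pi_gt0 //.
  by rewrite ltr_pdivrMr ?ltr0n // mul1r ltr_nat.
have := sin_gt0_pi sp; have := cos2Dsin2 s => /= h1 h2 h3; clear zN; nra.
Qed.

Lemma sum_unity (N : nat) (z : C) n : (0 < N)%N -> (forall n, (z ^+ n == 1) = (N %| n)%N) ->
  \sum_(j < N) (z ^+ j) ^+ n = if (N %| n)%N then N%:R else 0.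
Proof.
move=> N0 hz; under eq_bigr do rewrite exprAC.
rewrite -hz; case: eqP => [->|/eqP zn].
  by under eq_bigr do rewrite expr1n; rewrite sumr_const card_ord.
apply: (@mulfI _ (z ^+ n - 1)); first by rewrite subr_eq0.
have /eqP zN : z ^+ N == 1 by rewrite hz.
by rewrite -subrX1 mulr0 exprAC zN expr1n subrr.
Qed.

(** Expand [1 / (u - k)], for [u ^+ N = 1], as the sum of the
    [u ^+ (N - 1 - i) * k ^+ i] for [i < N] divided by [1 - k ^+ N]; summing over
    [u] retains the term [i = q].  For large [N] the right-hand side approaches
    [N k ^+ q] when [|k| < 1] and 0 when [|k| > 1], as the residue theorem
    predicts. *)
Lemma residue_sum (N q : nat) (z k : C) : (q < N)%N -> (forall n, (z ^+ n == 1) = (N %| n)%N) ->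
  k ^+ N != 1 ->
  \sum_(j < N) (z ^+ j) ^+ q.+1 / (z ^+ j - k) = N%:R * (k ^+ q / (1 - k ^+ N)).
Proof.
move=> qN hz kN; have N0 : (0 < N)%N by exact: leq_ltn_trans qN.
have kN' : 1 - k ^+ N != 0 by rewrite subr_eq0 eq_sym.
have zjN (j : nat) : (z ^+ j) ^+ N = 1.
  by rewrite exprAC; have := hz N; rewrite dvdnn => /eqP ->; rewrite expr1n.
transitivity (\sum_(j < N) \sum_(i < N) (z ^+ j) ^+ (q + N - i) * (k ^+ i / (1 - k ^+ N))).
  apply: eq_bigr => j _; set w := z ^+ j.
  have wk : w - k != 0.
    by apply: contra kN; rewrite subr_eq0 => /eqP <-; rewrite /w zjN.
  apply: (mulIf wk); rewrite divfK // mulr_suml.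
  have -> : w ^+ q.+1 = w ^+ q.+1 * ((w ^+ N - k ^+ N) / (1 - k ^+ N)).
    by rewrite /w zjN divff // mulr1.
  rewrite subrXX !mulrA mulr_sumr !mulr_suml; apply: eq_bigr => i _.
  have -> : (q + N - i = q.+1 + (N.-1 - i))%N by have := ltn_ord i; lia.
  by rewrite exprD; field.
rewrite exchange_big /= (bigD1 (Ordinal qN)) //= [X in _ + X]big1 ?addr0.
  by rewrite -mulr_suml sum_unity // addKn dvdnn.
move=> i iq; rewrite -mulr_suml sum_unity //.
rewrite ifF ?mul0r //; apply/negP => /dvdnP[c hc].
have iN := ltn_ord i; have {}iq : (i : nat) <> q by move=> e; move/eqP: iq; apply; apply: val_inj.
case: c hc => [|[|c]]; rewrite ?mul0n ?mul1n; [lia|lia|].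
by rewrite !mulSn; lia.
Qed.

Lemma log_deriv (s : seq C) (c w : C) : c != 0 -> (forall k, k \in s -> w != k) ->
  let P := c *: \prod_(k <- s) ('X - k%:P) in
  P^`().[w] / P.[w] = \sum_(k <- s) (w - k)^-1.
Proof.
move=> c0 hs /=; rewrite derivZ !hornerZ invfM mulrACA divff // mul1r.
elim: s hs => [|k s IH] hs.
  by rewrite !big_nil derivC horner0 mul0r.
have wk : w - k != 0 by rewrite subr_eq0 hs ?mem_head.
have {}IH := IH (fun i si => hs i (mem_behead (s := k :: s) si)).
set P := \prod_(k <- s) _ in IH *.
have P0 : P.[w] != 0.
  rewrite -/(root P w) /P root_prod_XsubC; apply/negP => ws.
  by have := hs w (mem_behead (s := k :: s) ws); rewrite eqxx.
rewrite !big_cons -IH -/P derivM derivXsubC !hornerE; field.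
by rewrite wk P0.
Qed.

End RootsOfUnity.

(** * Newton's identities and reduction modulo the polynomial of the roots *)

Section SymmetricFunctions.
Variable R : realType.
Local Notation C := (cplx R).
Implicit Types s : seq C.

Definition psum (q : nat) s : C := \sum_(x <- s) x ^+ q.

Definition rev_poly s : {poly C} := \prod_(x <- s) (1 - x *: 'X).

Definition root_poly s : {poly C} := \prod_(x <- s) ('X - x%:P).

Lemma rev_poly_cons x s : rev_poly (x :: s) = (1 - x *: 'X) * rev_poly s.
Proof. exact: big_cons. Qed.

Lemma root_poly_cons x s : root_poly (x :: s) = ('X - x%:P) * root_poly s.
Proof. exact: big_cons. Qed.

(** Logarithmic derivative of [rev_poly s]: that of [1 - x X] times [- X] is the
    geometric series of the [x ^+ i X ^+ i] for [i > 0].  Truncating this series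
    after the degree [n] costs a multiple of [X ^+ (n + 1)]. *)
Lemma newton_trunc s n : exists T : {poly C},
  'X * (rev_poly s)^`() + rev_poly s * \sum_(x <- s) \sum_(i < n) x ^+ i.+1 *: 'X^(i.+1) =
  'X^(n.+1) * T.
Proof.
elim: s => [|x s [T hT]].
  by exists 0; rewrite /rev_poly !big_nil !mulr0 addr0 -[1]/(1%:P) derivC mulr0.
rewrite rev_poly_cons big_cons.
have hx : (1 - x *: 'X) * \sum_(i < n) x ^+ i.+1 *: 'X^(i.+1) =
    x *: 'X - x ^+ n.+1 *: 'X^(n.+1).
  rewrite (eq_bigr (fun i : 'I_n => (x *: 'X) * (x *: 'X) ^+ i)) => [|i _].
    rewrite -mulr_sumr mulrCA -[1 - _]opprB mulNr -subrX1 opprB.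
    by rewrite mulrBr mulr1 -exprS exprZn.
  by rewrite -exprS exprZn.
exists ((1 - x *: 'X) * T - x ^+ n.+1 *: rev_poly s).
have dx : (1 - x *: 'X : {poly C})^`() = - x%:P.
  by rewrite derivB derivZ derivX -polyC1 derivC sub0r alg_polyC.
rewrite derivM dx; move: hT hx; set G := \sum_(x <- s) _; set Gx := \sum_(i < n) _.
rewrite -!mul_polyC => hT hx.
transitivity ((1 - x%:P * 'X) * ('X * (rev_poly s)^`() + rev_poly s * G) +
   rev_poly s * ((1 - x%:P * 'X) * Gx - x%:P * 'X)); first by ring.
by rewrite hT hx; ring.
Qed.

Lemma newton s k :
  k%:R * (rev_poly s)`_k = - \sum_(i < k) psum i.+1 s * (rev_poly s)`_(k - i.+1).
Proof.
have [T hT] := newton_trunc s k.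
have : (rev_poly s * \sum_(x <- s) \sum_(i < k) x ^+ i.+1 *: 'X^(i.+1))`_k =
    \sum_(i < k) psum i.+1 s * (rev_poly s)`_(k - i.+1).
  rewrite exchange_big /= mulr_sumr coef_sum; apply: eq_bigr => i _.
  by rewrite -scaler_suml -scalerAr coefZ coefMXn ltnNge ltn_ord.
move=> <-; have := congr1 (fun p : {poly C} => p`_k) hT.
rewrite coefD coefXnM leqnn coefXM => /eqP; rewrite addr_eq0 => /eqP <-.
by case: k {T hT} => [|k]; rewrite ?mul0r // coef_deriv mulr_natl.
Qed.

Lemma rev_poly0 s : (rev_poly s)`_0 = 1.
Proof.
rewrite -horner_coef0 /rev_poly horner_prod big1 // => x _.
by rewrite hornerD hornerN hornerZ hornerX mulr0 subr0 -[1]/(1%:P) hornerC.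
Qed.

Lemma size_rev_poly s : (size (rev_poly s) <= (size s).+1)%N.
Proof.
elim: s => [|x s IH]; first by rewrite /rev_poly big_nil size_poly1.
rewrite rev_poly_cons (leq_trans (size_polyMleq _ _)) //.
have : (size (1 - x *: 'X)%R <= 2)%N.
  rewrite (leq_trans (size_polyD _ _)) // size_poly1 size_polyN geq_max /=.
  by rewrite (leq_trans (size_scale_leq _ _)) ?size_polyX.
move=> h; rewrite -subn1 leq_subLR (leq_trans (leq_add h IH)) //.
Qed.

Lemma size_root_poly s : size (root_poly s) = (size s).+1.
Proof. exact: size_prod_XsubC. Qed.

Lemma monic_root_poly s : root_poly s \is monic.
Proof. exact: monic_prod_XsubC. Qed.

Lemma root_poly_coef s j : (j <= size s)%N -> (root_poly s)`_j = (rev_poly s)`_(size s - j).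
Proof.
elim: s j => [|x s IH] j; first by rewrite leqn0 => /eqP ->; rewrite /root_poly /rev_poly !big_nil.
rewrite /= rev_poly_cons root_poly_cons => js.
rewrite !mulrBl mul1r -scalerAl !coefB coefZ coefCM !coefXM.
case: j js => [|j] js.
  rewrite subn0 /= IH // subn0 (nth_default _ (size_rev_poly s)) //.
rewrite subSS /= subn_eq0; rewrite ltnS in js; rewrite IH //.
case: ltnP => h.
  by rewrite IH // -subnS; case: (size s - j)%N (subn_gt0 j (size s)) => [|k]; rewrite ?h.
have -> : j = size s by apply/eqP; rewrite eqn_leq js h.
by rewrite (nth_default _ (_ : size (root_poly s) <= _)%N) ?size_root_poly // mulr0.
Qed.

(** This recursion makes the coefficients of the remainder polynomial in those
    of [Q]. *)
Fixpoint rem_Xn (Q : {poly C}) n q : {poly C} :=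
  if q is q'.+1 then 'X * rem_Xn Q n q' - (rem_Xn Q n q')`_n.-1 *: Q else 1.

Lemma size_rem_Xn (Q : {poly C}) n q : (0 < n)%N -> Q \is monic -> size Q = n.+1 ->
  (size (rem_Xn Q n q) <= n)%N.
Proof.
move=> n0 mQ sQ; elim: q => [|q IH] /=; first by rewrite size_poly1.
set c := rem_Xn Q n q in IH *.
apply/leq_sizeP => j nj; rewrite coefB coefXM coefZ gtn_eqF ?(leq_trans n0) //.
case: ltngtP nj => // [nj|<-] _.
  rewrite [Q`_j]nth_default ?sQ // mulr0 subr0 nth_default //.
  by rewrite (leq_trans IH) // -ltnS prednK // (leq_ltn_trans _ nj).
have -> : Q`_n = 1 by rewrite -[n]/(n.+1.-1) -sQ; apply/monicP.
by rewrite mulr1 subrr.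
Qed.

Lemma dvdp_rem_Xn (Q : {poly C}) n q : Q %| 'X^q - rem_Xn Q n q.
Proof.
elim: q => [|q IH] /=; first by rewrite expr0 subrr dvdp0.
rewrite exprS opprB addrA addrAC -mulrBr dvdp_add ?dvdp_mull //.
by rewrite -mul_polyC dvdp_mull.
Qed.

Section Family.
Variables (S : C -> seq C) (r : nat).
Hypothesis r0 : (0 < r)%N.
Hypothesis sizeS : forall w, `|w| <= 1 -> size (S w) = r.
Hypothesis psumS : forall q, (0 < q)%N -> disc_alg (fun w => psum q (S w)).

(** Newton's identity expresses the coefficient [k] in the preceding ones and in
    the power sums, as [k] is invertible. *)
Lemma disc_alg_rev_poly k : disc_alg (fun w => (rev_poly (S w))`_k).
Proof.
elim/ltn_ind: k => k IH.
have [->|k0] := posnP k.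
  by apply: disc_alg_ext (disc_alg_cst 1) => w _; rewrite rev_poly0.
apply: (@disc_alg_ext R (fun w => k%:R^-1 * - \sum_(i < k) psum i.+1 (S w) * (rev_poly (S w))`_(k - i.+1))).
  by move=> w _; rewrite -newton mulKf // pnatr_eq0 -lt0n.
apply: disc_algM; first exact: disc_alg_cst.
apply: disc_algN; apply: disc_alg_sum => i _; apply: disc_algM; first exact: psumS.
by apply: IH; have := ltn_ord i; lia.
Qed.

Lemma disc_alg_root_poly j : disc_alg (fun w => (root_poly (S w))`_j).
Proof.
have [jr|jr] := leqP j r.
  apply: disc_alg_ext (disc_alg_rev_poly (r - j)) => w w1.
  by rewrite root_poly_coef ?sizeS.
apply: disc_alg_ext (disc_alg_cst 0) => w w1.
by rewrite nth_default // size_root_poly sizeS.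
Qed.

Lemma disc_alg_root_poly_eval x : disc_alg (fun w => (root_poly (S w)).[x]).
Proof.
apply: (@disc_alg_ext R (fun w => \sum_(j < r.+1) (root_poly (S w))`_j * x ^+ j)).
  by move=> w w1; rewrite horner_coef size_root_poly sizeS.
apply: disc_alg_sum => j _; apply: disc_algM; first exact: disc_alg_root_poly.
exact: disc_alg_cst.
Qed.

Lemma disc_alg_rem_Xn q j : disc_alg (fun w => (rem_Xn (root_poly (S w)) r q)`_j).
Proof.
elim: q j => [|q IH] j /=.
  by apply: disc_alg_ext (disc_alg_cst (1 : {poly C})`_j) => w _.
apply: (@disc_alg_ext R (fun w => (if j == 0%N then 0 else (rem_Xn (root_poly (S w)) r q)`_j.-1) -
    (rem_Xn (root_poly (S w)) r q)`_r.-1 * (root_poly (S w))`_j)).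
  by move=> w _; rewrite coefB coefXM coefZ.
apply: disc_algB; first by case: eqP => _; [exact: disc_alg_cst|exact: IH].
by apply: disc_algM; [exact: IH|exact: disc_alg_root_poly].
Qed.

Definition rem_mx m s : 'M[C]_(m, r) := \matrix_(q < m, j < r) (rem_Xn (root_poly s) r q)`_j.

Lemma disc_alg_det_rem m (B : 'M[C]_(r, m)) :
  disc_alg (fun w => \det (1%:M - w *: (B *m rem_mx m (S w)))).
Proof.
pose A (i j : 'I_r) w := (i == j)%:R - w * \sum_(q < m) B i q * (rem_Xn (root_poly (S w)) r q)`_j.
apply: (@disc_alg_ext R (fun w => \det (\matrix_(i, j) A i j w))).
  move=> w _; congr (\det _); apply/matrixP => i j; rewrite !mxE /A.
  by congr (_ - _ * _); apply: eq_bigr => q _; rewrite mxE.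
apply: disc_alg_det => i j; apply: disc_algB; first exact: disc_alg_cst.
apply: disc_algM; first exact: disc_alg_id.
by apply: disc_alg_sum => q _; apply: disc_algM; [exact: disc_alg_cst|exact: disc_alg_rem_Xn].
Qed.

End Family.
End SymmetricFunctions.

(** * Tuples of roots: separation, closeness up to order *)

Section FiniteMin.
Variable R : realType.
Local Notation C := (cplx R).

Lemma pos_min (x y : C) : 0 < x -> 0 < y -> exists m : C, [/\ 0 < m, m <= x & m <= y].
Proof.
move=> /gt0_re[-> x0] /gt0_re[-> y0].
exists (Num.min (complex.Re x) (complex.Re y))%:C%C; split; last 2 first.
- by rewrite lecR ge_min lexx.
- by rewrite lecR ge_min lexx orbT.
by rewrite ltcR lt_min x0.
Qed.

Lemma fin_lower (T : finType) (f : T -> C) : (forall c, 0 < f c) ->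
  exists2 m : C, 0 < m & forall c, m <= f c.
Proof.
move=> f0; suff [m m0 hm] : exists2 m : C, 0 < m & forall c, c \in enum T -> m <= f c.
  by exists m => // c; apply: hm; rewrite mem_enum.
elim: (enum T) => [|c s [m m0 hm]]; first by exists 1.
have [m' [m'0 h1 h2]] := pos_min m0 (f0 c); exists m' => // c'.
by rewrite inE => /predU1P[->//|/hm]; exact: le_trans.
Qed.

Lemma fin_separated (T : finType) (v : T -> C) :
  exists2 m : C, 0 < m & forall c c', `|v c - v c'| < m -> v c = v c'.
Proof.
have [|m m0 hm] := @fin_lower (T * T)%type
    (fun p => if v p.1 == v p.2 then 1 else `|v p.1 - v p.2|).
  by move=> [c c'] /=; case: eqVneq => // h; rewrite normr_gt0 subr_eq0.
exists m => // c c' h; have := hm (c, c') => /=; case: eqVneq => // _ /(lt_le_trans h).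
by rewrite ltxx.
Qed.

Lemma root_poly_eval_cont (u : seq C) (x e : C) : 0 < e ->
  exists2 d : C, 0 < d & forall s : seq C, size s = size u ->
    (forall i, (i < size u)%N -> `|s`_i - u`_i| < d) ->
    `|(root_poly s).[x] - (root_poly u).[x]| < e.
Proof.
elim: u e => [|y u IH] e e0.
  by exists 1 => // s /size0nil -> _; rewrite subrr normr0.
pose K := `|x - y| + 1; have K0 : 0 < K by rewrite ltr_wpDl.
pose M := `|(root_poly u).[x]| + 1; have M0 : 0 < M by rewrite ltr_wpDl.
have e2 : 0 < e / 2 by rewrite divr_gt0.
have [d d0 hd] := IH _ (divr_gt0 e2 K0).
have [d' [d'0 dd d1]] := pos_min d0 (@ltr01 C).
have [d'' [d''0 dd' d2]] := pos_min d'0 (divr_gt0 e2 M0).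
exists d'' => // -[|z s] // [ss] hs.
rewrite !root_poly_cons !hornerM !hornerXsubC.
have hz : `|z - y| < d'' := hs 0%N isT.
have hss : `|(root_poly s).[x] - (root_poly u).[x]| < e / 2 / K.
  apply: hd => // i iu; apply: lt_le_trans (hs i.+1 iu) _.
  exact: le_trans dd.
have -> : (x - z) * (root_poly s).[x] - (x - y) * (root_poly u).[x] =
   (x - z) * ((root_poly s).[x] - (root_poly u).[x]) + (y - z) * (root_poly u).[x] by ring.
rewrite (splitr e) (le_lt_trans (ler_normD _ _)) // !normrM.
apply: ltr_leD.
  have hK : `|x - z| <= K.
    rewrite -(subrKA y) (le_trans (ler_normD _ _)) // lerD2l distrC.
    by rewrite (le_trans (ltW hz)) // (le_trans dd').
  rewrite (le_lt_trans (ler_wpM2r _ hK)) // mulrC -ltr_pdivlMr //.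
rewrite distrC; have hM : `|(root_poly u).[x]| <= M by rewrite lerDl.
rewrite (le_trans (ler_wpM2l _ hM)) // -ler_pdivlMr // (le_trans (ltW hz)) //.
Qed.

Lemma convex_norm (t a b M : C) : 0 <= t -> t <= 1 -> `|a| <= M -> `|b| <= M ->
  `|(1 - t) * a + t * b| <= M.
Proof.
move=> t0 t1 aM bM; have t1' : 0 <= 1 - t by rewrite subr_ge0.
have -> : M = (1 - t) * M + t * M by ring.
rewrite (le_trans (ler_normD _ _)) // !normrM (ger0_norm t0) (ger0_norm t1').
by rewrite lerD // ler_wpM2l.
Qed.

Lemma norm_gt_half (w w0 : C) : `|w0| = 1 -> `|w - w0| < 2^-1 -> 2^-1 < `|w|.
Proof.
move=> w01 wd; have := ler_normD (w0 - w) w; rewrite subrK w01 distrC => h.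
rewrite -(ltrD2l `|w - w0|); apply: lt_le_trans h.
have one2 : 1 = 2^-1 + 2^-1 :> C by field.
by rewrite [ltRHS]one2 ltrD2r.
Qed.

(** As in [limit_roots], multisets are represented by sequences up to
    permutation. *)
Definition close_roots (r : nat) (e : C) (s u : seq C) := exists s' : seq C,
  [/\ perm_eq s' s, size s' = r & forall i, (i < r)%N -> `|s'`_i - u`_i| < e].

Lemma close_roots_perm r e (s u u' : seq C) : perm_eq u u' -> size u = r ->
  close_roots r e s u' -> close_roots r e s u.
Proof.
move=> uu' ur [s' [ss sr hs]].
have u'r : size u' = r by rewrite -ur (perm_size uu').
have /(perm_iotaP 0) [Is pI uI] := uu'.
have sI : size Is = r by rewrite (perm_size pI) size_iota.
exists [seq s'`_i | i <- Is]; split.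
- by apply: perm_trans ss; apply/(perm_iotaP 0); exists Is => //; rewrite sr -u'r.
- by rewrite size_map.
- move=> i ir; rewrite uI !(nth_map 0%N) ?sI //; apply: hs.
  have : Is`_i \in Is by rewrite mem_nth // sI.
  by rewrite (perm_mem pI) mem_iota u'r.
Qed.

Lemma prod_norm_lower (s : seq C) (x e : C) : 0 <= e -> (forall y, y \in s -> e <= `|x - y|) ->
  e ^+ size s <= `|(root_poly s).[x]|.
Proof.
move=> e0; elim: s => [|y s IH] h.
  by rewrite /root_poly big_nil -polyC1 hornerC normr1.
rewrite root_poly_cons hornerM hornerXsubC normrM exprS ler_pM ?exprn_ge0 ?h ?mem_head //.
by apply: IH => i si; apply: h; rewrite inE si orbT.
Qed.

End FiniteMin.

(** * Disc algebra by dilation and boundary continuity *)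

Section Dilations.
Variable R : realType.
Local Notation C := (cplx R).
Implicit Types f : C -> C.

Lemma dilation_unif f (rho : C) : 0 < rho -> disc_alg (fun w => f (rho * w)) ->
  forall e : C, 0 < e -> exists2 d : C, 0 < d & forall w w' : C,
    `|w| <= rho -> `|w'| <= rho -> `|w' - w| < d -> `|f w' - f w| < e.
Proof.
move=> p0 da e e0; have [d d0 hd] := disc_cont_unif (disc_alg_cont da) e0.
exists (d * rho); first by rewrite mulr_gt0.
have pn : rho != 0 by rewrite gt_eqF.
move=> w w' w1 w'1 ww.
have le1 v : `|v| <= rho -> `|v / rho| <= 1.
  by move=> h; rewrite normrM normfV (gtr0_norm p0) ler_pdivrMr // mul1r.
have := hd (w / rho) (w' / rho) (le1 _ w1) (le1 _ w'1).
rewrite -mulrBl normrM normfV (gtr0_norm p0) ltr_pdivrMr // => /(_ ww).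
by rewrite ![rho * (_ / _)]mulrC !divfK.
Qed.

Lemma inside_point (w d : C) : `|w| = 1 -> 0 < d ->
  exists2 w' : C, `|w'| < 1 & `|w' - w| < d.
Proof.
move=> w1 d0; have [k [k0 k1 k2]] := pos_min d0 (@ltr01 C).
have k3 : k / 2 < k by rewrite ltr_pdivrMr ?ltr0n // ltr_pMr // ltr1n.
have k4 : 0 < k / 2 by rewrite divr_gt0.
exists (w * (1 - k / 2)).
  rewrite normrM w1 mul1r ger0_norm ?gtrBl // subr_ge0.
  by rewrite (le_trans (ltW k3)).
rewrite mulrBr mulr1 addrAC subrr add0r normrN normrM w1 mul1r gtr0_norm //.
exact: lt_le_trans k1.
Qed.

(** The dilations of [f] are continuous, hence so is [f] in the open disc.  At a
    boundary point, limits from the open disc also control the nearby boundary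
    values, themselves limits from the open disc.  Thus [f] is uniformly
    continuous on the closed disc, and it is the uniform limit of its
    dilations. *)
Lemma dilations_disc_alg f :
  (forall rho : C, 0 < rho -> rho < 1 -> disc_alg (fun w => f (rho * w))) ->
  (forall w0 : C, `|w0| = 1 -> forall e : C, 0 < e -> exists2 d : C, 0 < d &
     forall w, `|w| < 1 -> `|w - w0| < d -> `|f w - f w0| < e) ->
  disc_alg f.
Proof.
move=> hf hb; have cf : disc_cont f.
  move=> w0 w01 e e0; have [w01'|w01'] := eqVneq `|w0| 1; last first.
    have k0 : 0 < 1 - `|w0| by rewrite subr_gt0 ltr1_norm.
    have k1 : 1 - `|w0| <= 1 by rewrite gerBl.
    pose k := (1 - `|w0|) / 2; have kp : 0 < k by rewrite divr_gt0.
    have kk : 1 - `|w0| = k + k by rewrite /k; field.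
    have w0E : `|w0| = 1 - k - k by rewrite -addrA -opprD -kk opprB addrC subrK.
    have p1 : 1 - k < 1 by rewrite gtrBl.
    have p0 : 0 < 1 - k.
      by rewrite subr_gt0 ltr_pdivrMr ?ltr0n // mul1r (le_lt_trans k1) // ltr1n.
    have [d d0 hd] := dilation_unif p0 (hf _ p0 p1) e0.
    have [d' [d'0 d'd d'k]] := pos_min d0 kp.
    exists d' => // w' _ ww; apply: hd.
    - by rewrite w0E gerBl ltW.
    - rewrite -(subrK w0 w') (le_trans (ler_normD _ _)) // w0E.
      by rewrite -[leRHS](subrK k) addrC lerD2l (le_trans (ltW ww)).
    - exact: lt_le_trans d'd.
  have e2 : 0 < e / 2 by rewrite divr_gt0.
  have [d d0 hd] := hb w0 w01' _ e2.
  exists (d / 2); first by rewrite divr_gt0.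
  move=> w w1 ww; have d2 : 0 < d / 2 by rewrite divr_gt0.
  have d2d : d / 2 < d by rewrite ltr_pdivrMr ?ltr0n // ltr_pMr // ltr1n.
  have [w1'|w1'] := eqVneq `|w| 1; last first.
    have e2e : e / 2 < e by rewrite ltr_pdivrMr ?ltr0n // ltr_pMr // ltr1n.
    by rewrite (lt_trans _ e2e) // hd ?ltr1_norm // (lt_trans ww).
  have [d1 d10 hd1] := hb w w1' _ e2.
  have [d3 [d30 d3d1 d3d]] := pos_min d10 d2.
  have [v v1 vw] := inside_point w1' d30.
  rewrite (splitr e) -(subrKA (f v)) (le_lt_trans (ler_normD _ _)) // ltrD //.
    by rewrite distrC hd1 // (lt_le_trans vw).
  rewrite hd // -(subrKA w) (le_lt_trans (ler_normD _ _)) // (splitr d) ltrD //.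
  exact: lt_le_trans d3d.
apply: disc_alg_lim => e e0; have [d d0 hd] := disc_cont_unif cf e0.
have [k [k0 k1 k2]] := pos_min d0 (@ltr01 C).
have k3 : k / 2 < k by rewrite ltr_pdivrMr ?ltr0n // ltr_pMr // ltr1n.
have k4 : 0 < k / 2 by rewrite divr_gt0.
have p0 : 0 < 1 - k / 2 by rewrite subr_gt0 (lt_le_trans k3).
have p1 : 1 - k / 2 < 1 by rewrite gtrBl.
exists (fun w => f ((1 - k / 2) * w)); first exact: hf.
move=> w w1; apply: hd => //.
  by rewrite normrM (gtr0_norm p0) (le_trans (ler_piMr _ w1)) // ltW.
have -> : w - (1 - k / 2) * w = (k / 2) * w by ring.
rewrite normrM (gtr0_norm k4) (le_lt_trans (ler_piMr _ w1)) ?ltW //.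
by rewrite (lt_le_trans k3).
Qed.

Lemma psum_cont (q : nat) (u : seq C) (e : C) : 0 < e ->
  exists2 d : C, 0 < d & forall s : seq C, size s = size u ->
    (forall i, (i < size u)%N -> `|s`_i - u`_i| < d) ->
    `|psum q s - psum q u| < e.
Proof.
elim: u e => [|y u IH] e e0.
  by exists 1 => // s /size0nil -> _; rewrite subrr normr0.
have e2 : 0 < e / 2 by rewrite divr_gt0.
have [d d0 hd] := IH _ e2.
have /cvgrPdist_lt /(_ _ e2) /nearP [d1 d10 hd1] := @continuous_poly R 'X^q y.
have [d2 [d20 d2d d2d1]] := pos_min d0 d10.
exists d2 => // -[|z s] // [ss] hs; rewrite /psum !big_cons -/(psum q s) -/(psum q u).
rewrite opprD addrACA (splitr e) (le_lt_trans (ler_normD _ _)) // ltrD //.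
  rewrite distrC; have := hd1 z; rewrite !hornerXn; apply.
  exact: lt_le_trans (hs 0%N isT) d2d1.
by apply: hd => // i iu; apply: lt_le_trans (hs i.+1 iu) d2d.
Qed.

Lemma psum_perm q (s s' : seq C) : perm_eq s s' -> psum q s = psum q s'.
Proof. exact: perm_big. Qed.

End Dilations.

(** * Roots of the characteristic equation *)

Section CharacteristicRoots.
Variable R : realType.
Local Notation C := (cplx R).
Local Notation re := (@complex.Re R).
Variables (A : {poly C}) (r : nat).
Hypothesis r0 : (0 < r)%N.
Hypothesis rA : (r < (size A).-1)%N.
Hypothesis A0 : A.[0] != 0.
Hypothesis A1 : forall u : C, `|u| = 1 -> `|A.[u]| <= 1.

Definition chi (z : C) : {poly C} := A - z *: 'X^r.
Definition all_roots (z : C) : seq C := sval (closed_field_poly_normal (chi z)).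
Definition disc_roots (z : C) : seq C := [seq x <- all_roots z | `|x| < 1].

Lemma size_chi z : size (chi z) = size A.
Proof.
rewrite /chi size_polyDl // size_polyN (leq_ltn_trans (size_scale_leq _ _)) //.
by rewrite size_polyXn; clear -rA; lia.
Qed.

Lemma chi_neq0 z : chi z != 0.
Proof. by rewrite -size_poly_gt0 size_chi; clear -rA; lia. Qed.

Lemma lead_chi z : lead_coef (chi z) = lead_coef A.
Proof.
rewrite /chi lead_coefDl // size_polyN (leq_ltn_trans (size_scale_leq _ _)) //.
by rewrite size_polyXn; clear -rA; lia.
Qed.

Lemma lead_A : lead_coef A != 0.
Proof. by rewrite -(lead_chi 0) lead_coef_eq0 chi_neq0. Qed.

Lemma chiE z : chi z = lead_coef A *: \prod_(x <- all_roots z) ('X - x%:P).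
Proof. by rewrite -(lead_chi z) /all_roots; case: closed_field_poly_normal. Qed.

Lemma mem_all_roots z x : (x \in all_roots z) = root (chi z) x.
Proof. by rewrite chiE rootZ ?lead_A // root_prod_XsubC. Qed.

Lemma size_all_roots z : size (all_roots z) = (size A).-1.
Proof. by rewrite -(size_chi z) chiE size_scale ?lead_A // size_prod_XsubC. Qed.

Lemma root_chi z x : root (chi z) x = (A.[x] == z * x ^+ r).
Proof. by rewrite /root !hornerE subr_eq0. Qed.

Lemma root_chi_neq0 z x : root (chi z) x -> x != 0.
Proof.
rewrite root_chi; apply: contraTneq => ->.
by rewrite expr0n gtn_eqF // mulr0 (negbTE A0).
Qed.

Lemma no_root_on_circle z x : 1 < `|z| -> root (chi z) x -> `|x| != 1.
Proof.
move=> z1; rewrite root_chi => /eqP e; apply/eqP => x1.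
have := A1 x1; rewrite e normrM normrX x1 expr1n mulr1 => /(lt_le_trans z1).
by rewrite ltxx.
Qed.

(** On the circle [|A| <= 1 < |z| = |z x ^+ r|]: the polynomials [chi z] and
    [- z X ^+ r] have the same winding number, hence as many roots in the disc. *)
Lemma size_disc_roots z : 1 < `|z| -> size (disc_roots z) = r.
Proof.
move=> z1; have n0 x : `|x| = 1 -> (chi z).[x] != 0.
  by move=> x1; apply: contraPN (no_root_on_circle z1 (x := x)) => h; rewrite /root h x1 eqxx => /(_ isT).
have wz : has_wind (fun x : C => (- z) * x ^+ r) r.
  rewrite -[r in Posz r]add0n PoszD; apply: has_windM (has_wind_cst _) _.
  by have := has_wind_exp r (@has_wind_id R); rewrite -mulr_natr mul1r natz.
have wc : has_wind (fun x => (chi z).[x]) r.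
  apply: rouche wz.
  - exact: circle_cont_poly.
  - have := @circle_cont_poly R (- z *: 'X^r); apply: circle_cont_ext => x _.
    by rewrite !hornerE.
  - move=> x x1; rewrite /chi !hornerE mulNr opprK subrK normrN normrM normrX x1.
    by rewrite expr1n mulr1 (le_lt_trans (A1 x1)).
have := has_wind_unique n0 (poly_wind n0) wc.
by rewrite /disc_roots size_filter => /eqP; rewrite eqz_nat => /eqP.
Qed.

(** Uniform continuity on the disc of radius 2, brought back to the unit disc by
    the substitution of [2 X] for [X]. *)
Lemma poly_near_circle (q : {poly C}) (e : C) : 0 < e -> exists2 d : R, 0 < d &
  forall x : C, x != 0 -> `|x| <= 2 -> `| `|x| - 1| < d%:C%C -> `|q.[x] - q.[x / `|x|]| < e.
Proof.
move=> e0; have := disc_alg_cont (@disc_alg_poly R (q \Po (2%:P * 'X))).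
move=> /disc_cont_unif /(_ e e0) [d d0 hd]; have [ed rd0] := gt0_re d0.
exists (re d) => // x x0 x2 xd.
have n0 : `|x| != 0 by rewrite normr_eq0.
have half w : (q \Po (2%:P * 'X)).[w / 2] = q.[w].
  by rewrite horner_comp hornerM hornerC hornerX mulrC divfK ?pnatr_eq0.
have := hd (x / `|x| / 2) (x / 2) _ _ _; rewrite !half; apply.
- by rewrite !normrM !normfV normr_id divff // mul1r normr_nat invf_le1 ?ltr0n // ler1n.
- by rewrite normrM normfV normr_nat ler_pdivrMr ?ltr0n // mul1r.
- have -> : x / 2 - x / `|x| / 2 = (x / `|x|) * (`|x| - 1) / 2 by field.
  rewrite !normrM !normfV normr_id divff // mul1r normr_nat ltr_pdivrMr ?ltr0n //.
  by rewrite (lt_le_trans xd) // -ed ler_pMr // ler1n.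
Qed.

(** At a root, [|A x| = |z| |x| ^+ r]; if [x] is close to the circle, the left-hand
    side is at most slightly more than 1 and the right-hand side at least
    slightly less than [1 / rho > 1]. *)
Lemma root_gap (rho : C) : 0 < rho -> rho < 1 -> exists b : C, [/\ 0 < b, b < 1 &
  forall z x, rho^-1 <= `|z| -> root (chi z) x -> `|x| <= b \/ b^-1 <= `|x|].
Proof.
move=> p0 p1; pose e := (1 - rho) / 4%:R.
have s0 : 0 < 1 - rho by rewrite subr_gt0.
have e0 : 0 < e by rewrite divr_gt0 // ltr0n.
have [d1 d10 h1] := poly_near_circle A e0.
have [d2 d20 h2] := poly_near_circle 'X^r e0.
pose d : R := Num.min 1 (Num.min d1 d2).
have d0 : 0 < d by rewrite !lt_min ltr01 d10.
pose b : C := (1 + d%:C%C)^-1.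
have dC0 := real_gt0 d0.
have d1C : 0 < 1 + d%:C%C by rewrite addr_gt0 // ltr01.
exists b; split; rewrite ?invr_gt0 // ?invf_lt1 ?ltrDl // => z x hz hx.
have x0 := root_chi_neq0 hx.
(* [b > 1 - d] and [b^-1 = 1 + d] *)
have [xb|xb] := boolP (`|x| <= b); first by left.
have [xb'|xb'] := boolP (b^-1 <= `|x|); first by right.
move: xb xb'; rewrite invrK -!real_ltNge ?normr_real ?gtr0_real ?invr_gt0 // => xb xb'.
exfalso.
have db : 1 - d%:C%C < b.
  rewrite /b -(ltr_pM2r d1C) mulVf ?gt_eqF // mulrDr mulr1 mulrBl mul1r.
  by rewrite addrA subrK gtrBl mulr_gt0.
have xd : `| `|x| - 1| < d%:C%C.
  rewrite real_ltr_norml ?realB ?normr_real ?real1 // ltrBrDr addrC (lt_trans db) //=.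
  by rewrite ltrBlDr addrC.
have dle : d%:C%C <= 1 :> C by rewrite (_ : (1 : C) = 1%:C%C) // lecR ge_min lexx.
have x2 : `|x| <= 2 by rewrite (le_trans (ltW xb')) // -[2]/(1 + 1) lerD2l.
have n0 : `|x| != 0 by rewrite normr_eq0.
have u1 : `|x / `|x| | = 1 by rewrite normrM normfV normr_id divff.
have hA : `|A.[x]| < 1 + e.
  rewrite -(subrK A.[x / `|x|] A.[x]) (le_lt_trans (ler_normD _ _)) // addrC.
  rewrite ler_ltD ?A1 // h1 // (lt_le_trans xd) // lecR !ge_min lexx orbT //.
have hX : 1 - e < `|x| ^+ r.
  have : `|'X^r.[x] - 'X^r.[x / `|x|]| < e.
    by rewrite h2 // (lt_le_trans xd) // lecR !ge_min lexx !orbT.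
  rewrite !hornerE => h; rewrite ltrBlDr -normrX.
  have := ler_normB (x ^+ r - (x / `|x|) ^+ r) (x ^+ r).
  rewrite addrAC subrr add0r normrN [`|(x / _) ^+ r|]normrX u1 expr1n => h3.
  by rewrite (le_lt_trans h3) // addrC ltrD2l.
move: hx; rewrite root_chi => /eqP eA.
move: hA; rewrite eA normrM normrX => hA.
have : rho^-1 * (1 - e) < 1 + e.
  have e1 : 0 <= 1 - e.
    have -> : 1 - e = 3%:R / 4%:R + rho / 4%:R by rewrite /e; field.
    by rewrite ltW // addr_gt0 // divr_gt0 // ltr0n.
  by apply: le_lt_trans hA; apply: ler_pM => //; [rewrite invr_ge0 ltW|rewrite ltW].
rewrite mulrC ltr_pdivrMr // => bad.
have : 0 < (1 - rho) / 2 + e * (1 - rho) by rewrite addr_gt0 ?mulr_gt0 ?invr_gt0 ?ltr0n.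
have -> : (1 - rho) / 2 + e * (1 - rho) = (1 - e) - (1 + e) * rho by rewrite /e; field.
by rewrite subr_gt0 => /(lt_trans bad); rewrite ltxx.
Qed.

(** At [w = 0], that is [z] infinite, the [r] inside roots have all reached 0. *)
Definition inner_roots (w : C) : seq C :=
  if w == 0 then nseq r 0 else disc_roots w^-1.

Lemma size_inner_roots w : `|w| < 1 -> size (inner_roots w) = r.
Proof.
rewrite /inner_roots; case: eqVneq => [_ _|w0 w1]; first by rewrite size_nseq.
by rewrite size_disc_roots // normfV invf_gt1 ?normr_gt0.
Qed.

(** By [residue_sum] this is the contribution of the root [x] to the error of the
    trapezoidal sum, in the two cases of [root_gap]. *)
Lemma residue_error (b : C) (N q : nat) (x : C) : (q < N)%N -> 0 < b -> b < 1 ->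
  (`|x| <= b \/ b^-1 <= `|x|) ->
  `|x ^+ q / (1 - x ^+ N) - (if `|x| < 1 then x ^+ q else 0)| <=
     b ^+ (N - q) / (1 - b ^+ (N - q)).
Proof.
move=> qN b0 b1 xb; set c := b ^+ (N - q).
have b0' := ltW b0; have b1' := ltW b1.
have bn j : 0 <= b ^+ j <= 1 by rewrite exprn_ge0 // exprn_ile1.
have c1 : c < 1 by rewrite exprn_ilt1 // subn_eq0 -ltnNge.
have c0 : 0 < 1 - c by rewrite subr_gt0.
have Nq : N = (N - q + q)%N by rewrite subnK // ltnW.
have bNc : b ^+ N <= c.
  by rewrite {1}Nq exprD /c; case/andP: (bn (N - q)%N) => ? _; case/andP: (bn q) => _ ?; rewrite ler_piMr.
have key (y u : C) : `|y| <= b -> `|u| <= c -> `|u / (1 - y ^+ N)| <= c / (1 - c).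
  move=> yb uc; have yN : `|y ^+ N| <= c.
    by rewrite normrX (le_trans _ bNc) // lerXn2r ?nnegrE.
  have h : 1 - c <= `|1 - y ^+ N|.
    by rewrite (le_trans _ (lerB_dist _ _)) // normr1 lerD2l lerN2.
  rewrite normrM normfV ler_pM ?invr_ge0 // lef_pV2 ?posrE //.
  exact: lt_le_trans h.
case: xb => xb.
  have x1 : `|x| < 1 by exact: le_lt_trans b1.
  rewrite x1; have n0 : 1 - x ^+ N != 0.
    rewrite subr_eq0 eq_sym; apply/eqP => /(congr1 Num.norm); rewrite normrX normr1 => /eqP.
    by rewrite lt_eqF // exprn_ilt1 // -lt0n (leq_ltn_trans _ qN).
  have -> : x ^+ q / (1 - x ^+ N) - x ^+ q = x ^+ (N + q) / (1 - x ^+ N).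
    by rewrite exprD; field.
  apply: key => //; rewrite normrX (le_trans _ bNc) //.
  rewrite exprD (le_trans (ler_piMr _ _)) ?exprn_ge0 ?exprn_ile1 //.
  - by rewrite (le_trans xb).
  - by rewrite lerXn2r ?nnegrE.
have x1 : 1 < `|x| by rewrite (lt_le_trans _ xb) // invf_gt1.
have x0 : x != 0 by rewrite -normr_gt0 (lt_trans _ x1) // ltr01.
rewrite (lt_gtF x1) subr0.
have yb : `|x^-1| <= b by rewrite normfV -[b]invrK lef_pV2 ?posrE ?invr_gt0 ?normr_gt0.
have n0 : 1 - x ^+ N != 0.
  rewrite subr_eq0 eq_sym; apply/eqP => /(congr1 Num.norm); rewrite normrX normr1 => /eqP.
  by rewrite gt_eqF // exprn_egt1 // -lt0n (leq_ltn_trans _ qN).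
have n1 : 1 - x^-1 ^+ N != 0.
  rewrite subr_eq0 eq_sym exprVn invr_eq1; apply: contra n0 => /eqP ->.
  by rewrite subrr.
have -> : x ^+ q / (1 - x ^+ N) = - (x^-1 ^+ (N - q)) / (1 - x^-1 ^+ N).
  have xN : x ^+ N = x ^+ (N - q) * x ^+ q by rewrite -exprD -Nq.
  have X0 : x ^+ (N - q) != 0 by rewrite expf_neq0.
  have Y0 : x ^+ q != 0 by rewrite expf_neq0.
  rewrite !exprVn xN; rewrite xN in n0; move: X0 Y0 n0.
  move: (x ^+ (N - q)) (x ^+ q) => X Y X0 Y0 n0.
  have n2 : X * Y - 1 != 0 by rewrite -oppr_eq0 opprB.
  by field; rewrite ?n0 ?n2 ?X0 ?Y0.
apply: key => //; rewrite normrN normrX.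
by rewrite lerXn2r ?nnegrE.
Qed.

(** The trapezoidal sum of the Cauchy integral of [x ^+ q * chi' / chi] at
    [(rho * w)^-1]; numerator and denominator have been multiplied by [rho * w],
    which makes sense of it at [w = 0]. *)
Definition trap (rho : C) (q N : nat) (z : C) (w : C) : C :=
  N%:R^-1 * \sum_(j < N) (z ^+ j) ^+ q.+1 *
    ((r%:R / z ^+ j - rho * A^`().[z ^+ j] / (z ^+ j) ^+ r * w) *
     (1 - (rho * A.[z ^+ j] / (z ^+ j) ^+ r) * w)^-1).

Lemma disc_alg_trap rho q N z : `|rho| < 1 -> `|z| = 1 -> disc_alg (trap rho q N z).
Proof.
move=> p1 z1; apply: disc_algM; first exact: disc_alg_cst.
apply: disc_alg_sum => j _; apply: disc_algM; first exact: disc_alg_cst.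
apply: disc_algM.
  apply: disc_algB; first exact: disc_alg_cst.
  by apply: disc_algM; [exact: disc_alg_cst|exact: disc_alg_id].
apply: disc_alg_geom; have zj : `|z ^+ j| = 1 by rewrite normrX z1 expr1n.
rewrite normrM normfV [`|(z ^+ j) ^+ r|]normrX zj expr1n invr1 mulr1 normrM.
by rewrite (le_lt_trans _ p1) // ler_piMr // A1.
Qed.

Lemma trapE rho q N z w : `|rho| < 1 -> 0 < rho -> (q < N)%N -> `|w| <= 1 -> w != 0 ->
  (forall n, (z ^+ n == 1) = (N %| n)%N) -> `|z| = 1 ->
  trap rho q N z w = \sum_(x <- all_roots (rho * w)^-1) x ^+ q / (1 - x ^+ N).
Proof.
move=> p1 p0 qN w1 w0 hz z1; set Z := (rho * w)^-1.
have N0 : (0 < N)%N by exact: leq_ltn_trans qN.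
have N0' : N%:R != 0 :> C by rewrite pnatr_eq0 -lt0n.
have rw0 : rho * w != 0 by rewrite mulf_neq0 // gt_eqF.
have Z1 : 1 < `|Z|.
  rewrite normfV invf_gt1 ?normr_gt0 // normrM (le_lt_trans _ p1) // ler_piMr //.
have zk j k : k \in all_roots Z -> z ^+ j != k.
  rewrite mem_all_roots => /(no_root_on_circle Z1); apply: contraNneq => <-.
  by rewrite normrX z1 expr1n.
have kN k : k \in all_roots Z -> k ^+ N != 1.
  rewrite mem_all_roots => /(no_root_on_circle Z1); apply: contraNneq => kN.
  by have /eqP := congr1 Num.norm kN; rewrite normrX normr1 pexpr_eq1.
rewrite /trap; apply: (mulfI N0'); rewrite mulrA divff // mul1r mulr_sumr.
transitivity (\sum_(j < N) \sum_(k <- all_roots Z) (z ^+ j) ^+ q.+1 / (z ^+ j - k)).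
  apply: eq_bigr => j _; rewrite -mulr_sumr; congr (_ * _).
  have /= <- := @log_deriv R (all_roots Z) (lead_coef A) (z ^+ j) lead_A (zk j).
  rewrite -chiE; set u := z ^+ j.
  have u0 : u != 0 by rewrite -normr_gt0 /u normrX z1 expr1n ltr01.
  have c0 : (chi Z).[u] != 0.
    by rewrite -/(root _ _) -mem_all_roots; apply/negP => /(zk j); rewrite eqxx.
  have v0 : u ^+ r != 0 by rewrite expf_neq0.
  have rho0 : rho != 0 by rewrite gt_eqF.
  have e1 : (chi Z).[u] = - (Z * u ^+ r) * (1 - rho * A.[u] / u ^+ r * w).
    rewrite /chi !hornerE /Z; move: v0; set v := u ^+ r => v0; field.
    by rewrite ?w0 ?v0 ?rho0.
  have e2 : (chi Z)^`().[u] = A^`().[u] - Z * (u ^+ r * (r%:R / u)).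
    rewrite /chi derivB derivZ derivXn hornerD hornerN hornerZ hornerMn hornerXn.
    congr (_ - _ * _); have -> : u ^+ r = u * u ^+ r.-1 by rewrite -exprS prednK.
    by rewrite -mulr_natr; field.
  move: c0; rewrite e1 e2 mulf_eq0 negb_or => /andP[_ c0].
  move: v0 c0; set c := 1 - _; set v := u ^+ r => v0 c0; rewrite /Z; field.
  by rewrite ?w0 ?v0 ?rho0 ?c0 ?u0.
rewrite exchange_big /=; rewrite big_seq [RHS]big_seq; apply: eq_bigr => k ks.
by rewrite residue_sum // kN.
Qed.

Lemma disc_alg_psum rho q : 0 < rho -> rho < 1 -> (0 < q)%N ->
  disc_alg (fun w => psum q (inner_roots (rho * w))).
Proof.
move=> p0 p1 q0; have [b [b0 b1 hb]] := root_gap p0 p1.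
apply: disc_alg_lim => e e0; pose n : C := (size A)%:R.
have n0 : 0 < n by rewrite ltr0n; lia.
have half0 : 0 < 2^-1 :> C by rewrite invr_gt0 ltr0n.
have en0 : 0 < e / (2 * n) by rewrite divr_gt0 // mulr_gt0 // ltr0n.
have [N1 hN1] := small_exp (ltW b0) b1 half0.
have [N2 hN2] := small_exp (ltW b0) b1 en0.
(* so that both bounds hold for [N - q], the exponent in [residue_error] *)
pose N := (maxn N1 N2 + q).+1.
have qN : (q < N)%N by rewrite /N; lia.
have N1q : (N1 <= N - q)%N by rewrite /N; lia.
have N2q : (N2 <= N - q)%N by rewrite /N; lia.
have [|z hz] := @unity_root_exists R N; first by [].
have z1 : `|z| = 1.
  have /eqP zN : z ^+ N == 1 by rewrite hz.
  by have /eqP := congr1 Num.norm zN; rewrite normrX normr1 pexpr_eq1 // => /eqP.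
have np1 : `|rho| < 1 by rewrite gtr0_norm.
exists (trap rho q N z); first exact: disc_alg_trap.
move=> w w1; have [->|w0] := eqVneq w 0.
  rewrite mulr0 /inner_roots eqxx /psum big1_seq; last first.
    by move=> x /andP[_]; rewrite mem_nseq => /andP[_ /eqP ->]; rewrite expr0n gtn_eqF.
  rewrite /trap (eq_bigr (fun j : 'I_N => r%:R * (z ^+ j) ^+ q)) => [|j _].
    rewrite -mulr_sumr sum_unity // ifN ?mulr0 ?subr0 ?normr0 //.
    by rewrite gtnNdvd.
  have zj : z ^+ j != 0 by rewrite -normr_gt0 normrX z1 expr1n ltr01.
  by rewrite !mulr0 !subr0 invr1 mulr1 exprS; field.
set c := b ^+ (N - q).
rewrite trapE // /inner_roots mulf_eq0 gt_eqF //= (negbTE w0) distrC.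
set Z := (rho * w)^-1.
have -> : psum q (disc_roots Z) = \sum_(x <- all_roots Z) (if `|x| < 1 then x ^+ q else 0).
  by rewrite /psum /disc_roots big_filter big_mkcond.
rewrite -sumrB.
have Zr : rho^-1 <= `|Z|.
  rewrite normfV normrM (gtr0_norm p0) lef_pV2 ?posrE ?mulr_gt0 ?normr_gt0 //.
  by rewrite ler_piMr // ltW.
apply: (@le_lt_trans _ _ (\sum_(x <- all_roots Z) c / (1 - c))).
  apply: (le_trans (ler_norm_sum _ _ _)); rewrite big_seq [leRHS]big_seq.
  apply: ler_sum => x; rewrite mem_all_roots => hx.
  exact: residue_error qN b0 b1 (hb _ _ Zr hx).
rewrite big_const_seq count_predT size_all_roots iter_addr_0 -mulr_natr.
have c0 : 0 <= c by rewrite exprn_ge0 // ltW.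
have c2 : c < 2^-1 := hN1 _ N1q.
have c2' : 2^-1 < 1 - c.
  by rewrite ltrBrDr -ltrBrDl (_ : 1 - 2^-1 = 2^-1) //; field.
have cn : c * n < e / 2.
  have h : c < e / (2 * n) := hN2 _ N2q.
  rewrite (_ : e / 2 = e / (2 * n) * n) ?ltr_pM2r //; field.
  by rewrite gt_eqF.
have c1 : 0 < 1 - c by rewrite (lt_trans half0).
rewrite mulrAC ltr_pdivrMr //; apply: (@le_lt_trans _ _ (c * n)).
  by rewrite ler_wpM2l // ler_nat leq_pred.
by rewrite (lt_trans cn) // ltr_pM2l.
Qed.

Lemma inner_root_lt1 w x : x \in inner_roots w -> `|x| < 1.
Proof.
rewrite /inner_roots; case: eqP => _.
  by rewrite mem_nseq => /andP[_ /eqP ->]; rewrite normr0 ltr01.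
by rewrite mem_filter => /andP[].
Qed.

(** If [x] is a root for [w], then the polynomial at [w0] takes a small value at
    [x]; as it is the product of the [x - y] over its roots [y], up to a
    constant, one of these factors is small. *)
Lemma root_near (w0 : C) : `|w0| = 1 -> forall e : C, 0 < e ->
  exists2 d : C, 0 < d & forall w, `|w - w0| < d ->
    forall x, x \in inner_roots w -> exists2 y, y \in all_roots w0^-1 & `|x - y| < e.
Proof.
move=> w01 e e0; set t := all_roots w0^-1.
have L0 : 0 < `|lead_coef A| by rewrite normr_gt0 lead_A.
have half0 : 0 < 2^-1 :> C by rewrite invr_gt0 ltr0n.
have m0 : 0 < `|lead_coef A| * e ^+ size t / 2 by rewrite !mulr_gt0 ?exprn_gt0.
have [d [d0 dh dm]] := pos_min half0 m0.
exists d => // w wd x xw; have x1 := inner_root_lt1 xw.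
have w2 : 2^-1 < `|w|.
  by apply: norm_gt_half w01 _; exact: lt_le_trans dh.
have wn : w != 0 by rewrite -normr_gt0 (lt_trans half0).
have w0n : w0 != 0 by rewrite -normr_gt0 w01 ltr01.
have chix : (chi w0^-1).[x] = (w^-1 - w0^-1) * x ^+ r.
  move: xw; rewrite /inner_roots (negbTE wn) mem_filter => /andP[_].
  rewrite mem_all_roots root_chi => /eqP hA.
  by rewrite /chi !hornerE hA; ring.
have small : `|(chi w0^-1).[x]| < `|lead_coef A| * e ^+ size t.
  rewrite chix normrM (le_lt_trans (ler_piMr _ _)) //; first by rewrite normrX exprn_ile1 // ltW.
  have -> : w^-1 - w0^-1 = (w0 - w) / (w * w0) by field; rewrite wn w0n.
  rewrite normrM normfV normrM w01 mulr1 ltr_pdivrMr ?normr_gt0 // distrC.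
  rewrite (lt_le_trans wd) // (le_trans dm) // ler_pM2l ?ltW //.
  by rewrite mulr_gt0 // exprn_gt0.
have [/hasP[y yt hy]|/hasPn hn] := boolP (has (fun y => `|x - y| < e) t); first by exists y.
exfalso; move: small; rewrite chiE hornerZ normrM ltr_pM2l // => small.
suff : e ^+ size t <= `|(root_poly t).[x]| by move=> /(lt_le_trans small); rewrite ltxx.
apply: prod_norm_lower; first exact: ltW.
by move=> y /hn; rewrite -real_leNgt // ?gtr0_real ?normr_real.
Qed.

Lemma inner_eval_cont (x : C) (rho : C) : 0 < rho -> rho < 1 -> forall e : C, 0 < e ->
  exists2 d : C, 0 < d & forall w w' : C, `|w| <= rho -> `|w'| <= rho -> `|w' - w| < d ->
    `|(root_poly (inner_roots w')).[x] - (root_poly (inner_roots w)).[x]| < e.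
Proof.
move=> p0 p1 e e0.
have sz w : `|w| <= 1 -> size (inner_roots (rho * w)) = r.
  move=> w1; apply: size_inner_roots => //.
  by rewrite normrM gtr0_norm // (le_lt_trans (ler_piMr _ w1)) // ltW.
have da := disc_alg_root_poly_eval r0 sz (fun q => disc_alg_psum p0 p1) x.
exact: (dilation_unif p0 da e0).
Qed.

(** The inside roots form a tuple close to one of the finitely many tuples
    [cand c] of roots at [w0].  The values at a point [x] where the distinct
    polynomials [root_poly (cand c)] take distinct values show that, by
    continuity, it cannot pass from one of them to another as [w] varies. *)
Lemma inner_roots_limit (w0 : C) : `|w0| = 1 -> exists2 u : seq C, size u = r &
  forall e : C, 0 < e -> exists2 d : C, 0 < d &
    forall w, `|w| < 1 -> `|w - w0| < d -> close_roots r e (inner_roots w) u.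
Proof.
move=> w01; set t := all_roots w0^-1.
pose T : finType := r.-tuple 'I_(size t).
pose cand (c : r.-tuple 'I_(size t)) : seq C := [seq t`_(nat_of_ord i) | i <- c].
have scand c : size (cand c) = r by rewrite size_map size_tuple.
have [x hx] : exists x : C, forall c c', (root_poly (cand c)).[x] = (root_poly (cand c')).[x] ->
    root_poly (cand c) = root_poly (cand c').
  (* a polynomial vanishing wherever two distinct polynomials agree *)
  pose P := \prod_(p : T * T) (if root_poly (cand p.1) == root_poly (cand p.2) then 1
     else root_poly (cand p.1) - root_poly (cand p.2)).
  have /closed_nonrootP [x hx] : P != 0.
    by apply/prodf_neq0 => p _; case: ifPn => [_|h]; rewrite ?oner_eq0 ?subr_eq0.
  exists x => c c' e; apply/eqP/negPn/negP => ne.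
  move: hx; rewrite /P rootE horner_prod => /prodf_neq0 /(_ (c, c') isT) /=.
  by rewrite (negbTE ne) !hornerE e subrr eqxx.
pose v c := (root_poly (cand c)).[x].
pose g w := (root_poly (inner_roots w)).[x].
(* distinct values [v c] are at distance at least [m] *)
have [m m0 hm] := fin_separated v.
have m3 : 0 < m / 3%:R by rewrite divr_gt0 // ltr0n.
have /choice[d1 hd1] : forall c : T, exists d : C, 0 < d /\ forall s : seq C, size s = size (cand c) ->
    (forall i, (i < size (cand c))%N -> `|s`_i - (cand c)`_i| < d) ->
    `|(root_poly s).[x] - (root_poly (cand c)).[x]| < m / 3%:R.
  by move=> c; have [d d0 hd] := root_poly_eval_cont (cand c) x m3; exists d.
have [|e1 e10 he1] := @fin_lower R T d1; first by move=> c; have [] := hd1 c.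
have near e : 0 < e -> exists2 d : C, 0 < d & forall w, `|w| < 1 -> `|w - w0| < d ->
   exists c, forall i, (i < r)%N -> `|(inner_roots w)`_i - (cand c)`_i| < e.
  move=> e0; have [d d0 hd] := root_near w01 e0; exists d => // w w1 wd.
  have sz : size (inner_roots w) = r by apply: size_inner_roots.
  have /choice[j hj] : forall i : 'I_r, exists j : 'I_(size t), `|(inner_roots w)`_i - t`_j| < e.
    move=> i; have [|y yt hy] := hd w wd (inner_roots w)`_i; first by rewrite mem_nth // sz.
    have jt : (index y t < size t)%N by rewrite index_mem.
    by exists (Ordinal jt); rewrite /= nth_index.
  exists [tuple j i | i < r] => i ir; have := hj (Ordinal ir); rewrite /cand.
  rewrite (nth_map (j (Ordinal ir))) ?size_tuple // -[i in X in _ -> X]/(val (Ordinal ir)).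
  by rewrite -tnth_nth tnth_mktuple.
have [d d0 hd] := near _ e10.
have cval w c : `|w| < 1 -> (forall i, (i < r)%N -> `|(inner_roots w)`_i - (cand c)`_i| < e1) ->
    `|g w - v c| < m / 3%:R.
  move=> w1 hc; have [_ h] := hd1 c; apply: h; rewrite scand; first exact: size_inner_roots.
  by move=> i ir; apply: lt_le_trans (hc i ir) (he1 c).
(* The segment from [w1] to [w2] remains in the open disc and near [w0].  Along
   a fine subdivision [W] of it, [g] moves by less than [m / 3] at each step, so
   that it cannot pass from one value [v c] to another. *)
have const w1 w2 c : `|w1| < 1 -> `|w1 - w0| < d -> `|w2| < 1 -> `|w2 - w0| < d ->
    `|g w1 - v c| < m / 3%:R -> `|g w2 - v c| < m / 3%:R.
  move=> w1l w1d w2l w2d hw1.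
  have [rho [p0 p1 w1p w2p]] : exists rho : C, [/\ 0 < rho, rho < 1, `|w1| <= rho & `|w2| <= rho].
    have := @pos_min R (1 - `|w1|) (1 - `|w2|).
    rewrite !subr_gt0 => /(_ w1l w2l) [k [k0 k1 k2]].
    have k1' : k <= 1 by rewrite (le_trans k1) // gerBl.
    have kk : k / 2 <= k by rewrite ler_pdivrMr ?ltr0n // ler_pMr // ler1n.
    exists (1 - k / 2); split.
    - by rewrite subr_gt0 ltr_pdivrMr ?ltr0n // mul1r (le_lt_trans k1') // ltr1n.
    - by rewrite gtrBl divr_gt0.
    - by rewrite lerBrDr -lerBrDl (le_trans kk).
    - by rewrite lerBrDr -lerBrDl (le_trans kk).
  have [dl dl0 hdl] := inner_eval_cont x p0 p1 m3.
  have [N hN] := small_inv (divr_gt0 dl0 (ltr0n _ 2)).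
  pose th k : C := k%:R / N.+1%:R.
  have N0 : N.+1%:R != 0 :> C by rewrite pnatr_eq0.
  have th01 k : (k <= N.+1)%N -> 0 <= th k /\ th k <= 1.
    by move=> kN; rewrite divr_ge0 // ler_pdivrMr ?ltr0n // mul1r ler_nat.
  pose W k := w1 + th k * (w2 - w1).
  have conv k (y M : C) : (k <= N.+1)%N -> `|w1 - y| <= M -> `|w2 - y| <= M -> `|W k - y| <= M.
    move=> /th01 [t0 t1] h1 h2.
    have -> : W k - y = (1 - th k) * (w1 - y) + th k * (w2 - y) by rewrite /W; ring.
    exact: convex_norm.
  have Wp k : (k <= N.+1)%N -> `|W k| <= rho.
    by move=> kN; rewrite -[W k]subr0; apply: conv; rewrite ?subr0.
  have Wd k : (k <= N.+1)%N -> `|W k - w0| < d.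
    move=> kN; have := @pos_min R (d - `|w1 - w0|) (d - `|w2 - w0|).
    rewrite !subr_gt0 => /(_ w1d w2d) [l [l0 l1 l2]].
    apply: (@le_lt_trans _ _ (d - l)); last by rewrite gtrBl.
    by apply: conv => //; rewrite lerBrDr -lerBrDl.
  suff : `|g (W N.+1) - v c| < m / 3%:R.
    have -> // : W N.+1 = w2 by rewrite /W /th divff //; ring.
  have : (N.+1 <= N.+1)%N by [].
  elim: {1 3}N.+1 => [|k IH] kN; first by rewrite /W /th mul0r mul0r addr0.
  have Wl : `|W k.+1| < 1 by exact: le_lt_trans (Wp _ kN) p1.
  have [c' hc'] := hd _ Wl (Wd _ kN).
  have gc' := cval _ _ Wl hc'.
  suff -> : v c = v c' by [].
  apply/esym/hm; have {}IH := IH (ltnW kN).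
  have step : `|g (W k.+1) - g (W k)| < m / 3%:R.
    apply: hdl; rewrite ?Wp //; first exact: ltnW.
    have -> : W k.+1 - W k = N.+1%:R^-1 * (w2 - w1).
      by rewrite /W /th -addn1 natrD; field.
    have N1 : 0 < N.+1%:R^-1 :> C by rewrite invr_gt0 ltr0n.
    rewrite normrM (gtr0_norm N1).
    apply: (@le_lt_trans _ _ (N.+1%:R^-1 * 2)); last first.
      by rewrite -ltr_pdivlMr ?ltr0n // hN.
    by rewrite ler_pM2l // (le_trans (ler_normB _ _)) // -[2]/(1 + 1) lerD // ltW.
  have -> : v c' - v c = (g (W k.+1) - g (W k)) + (g (W k) - v c) - (g (W k.+1) - v c') by ring.
  have -> : m = m / 3%:R + m / 3%:R + m / 3%:R by field.
  by rewrite (le_lt_trans (ler_normB _ _)) // ltrD // (le_lt_trans (ler_normD _ _)) // ltrD.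
have [w1 w1l w1d] := inside_point w01 d0.
have [c1 hc1] := hd _ w1l w1d.
have gc1 := cval _ _ w1l hc1.
(* the value [v c1] is the only one taken near [w0], and it determines [cand c1]
   up to order *)
exists (cand c1); first exact: scand.
move=> e e0; have [e2 [e20 e2e e2e1]] := pos_min e0 e10.
have [d2 d20 hd2] := near _ e20.
have [d3 [d30 d3d d3d2]] := pos_min d0 d20.
exists d3 => // w wl wd.
have [c hc] := hd2 w wl (lt_le_trans wd d3d2).
have gw := const _ _ _ w1l w1d wl (lt_le_trans wd d3d) gc1.
have gc : `|g w - v c| < m / 3%:R.
  by apply: cval => // i ir; apply: lt_le_trans (hc i ir) _.
have vv : v c1 = v c.
  apply: hm; have -> : v c1 - v c = (g w - v c) - (g w - v c1) by ring.
  rewrite (le_lt_trans (ler_normB _ _)) //.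
  have -> : m = m / 3%:R + m / 3%:R + m / 3%:R by field.
  by rewrite -[ltLHS]addr0 ltrD // ltrD.
apply: (@close_roots_perm _ _ _ _ _ (cand c)) => //.
  exact: prod_XsubC_eq (hx _ _ vv).
exists (inner_roots w); split => //; first exact: size_inner_roots.
by move=> i ir; apply: lt_le_trans (hc i ir) _.
Qed.

End CharacteristicRoots.

(** * Confluent Vandermonde matrices *)

Section ConfluentVandermonde.
Variable R : realType.
Local Notation C := (cplx R).
Implicit Types (p : {poly C}) (s : seq C) (x : C).

(** The operator [X d/dX] maps [X ^+ q] to [q X ^+ q]: the value at [x] of its
    [k]-th iterate applied to ['X^q] is the entry [q ^+ k * x ^+ q] of the
    matrices below. *)
Definition euler p : {poly C} := 'X * p^`().

Lemma coef_euler1 p j : (euler p)`_j = j%:R * p`_j.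
Proof.
rewrite /euler coefXM; case: j => [|j]; first by rewrite mul0r.
by rewrite /= coef_deriv mulr_natl.
Qed.

Lemma coef_euler k p j : (iter k euler p)`_j = j%:R ^+ k * p`_j.
Proof.
elim: k => [|k IH]; first by rewrite expr0 mul1r.
by rewrite iterS coef_euler1 IH mulrA -exprS.
Qed.

Lemma eval_euler k p x n : (size p <= n)%N ->
  (iter k euler p).[x] = \sum_(j < n) p`_j * (j%:R ^+ k * x ^+ j).
Proof.
move=> pn; have sz : (size (iter k euler p) <= n)%N.
  apply/leq_sizeP => j nj; rewrite coef_euler nth_default ?mulr0 //.
  exact: leq_trans nj.
rewrite (horner_coef_wide _ sz); apply: eq_bigr => j _.
by rewrite coef_euler; ring.
Qed.

Lemma eulerB p q k : iter k euler (p - q) = iter k euler p - iter k euler q.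
Proof. by apply/polyP => j; rewrite !(coef_euler, coefB) mulrBr. Qed.

Lemma dvdp_euler x k p : ('X - x%:P) ^+ k.+1 %| p -> ('X - x%:P) ^+ k %| euler p.
Proof.
move=> /dvdpP [g ->]; rewrite /euler derivM deriv_exp derivXsubC mul1r /=.
apply: dvdp_mull; apply: dvdp_add.
  by rewrite exprS mulrA dvdp_mull.
by rewrite -mulr_natr mulrCA dvdp_mulr.
Qed.

Lemma euler_root x n k p : ('X - x%:P) ^+ n %| p -> (k < n)%N -> (iter k euler p).[x] = 0.
Proof.
move=> pn kn; have : ('X - x%:P) ^+ (n - k) %| iter k euler p.
  elim: k kn => [|k IH] kn; first by rewrite subn0.
  by rewrite iterS; apply: dvdp_euler; rewrite (subnSK (ltnW kn)); apply: IH; exact: ltnW.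
rewrite -(@prednK (n - k)) ?subn_gt0 // exprS => h.
apply/eqP; rewrite -/(root _ _) -dvdp_XsubCl; apply: dvdp_trans h.
exact: dvdp_mulr.
Qed.

(** Each application of the operator to [('X - x) ^+ k.+1 * g] lowers the exponent
    by one and multiplies the cofactor by [k.+1 * 'X], modulo ['X - x]. *)
Lemma euler_leading x k g :
  (iter k euler (('X - x%:P) ^+ k * g)).[x] = k`!%:R * x ^+ k * g.[x].
Proof.
elim: k g => [|k IH] g; first by rewrite /= !expr0 fact0 !mul1r.
rewrite iterSr (_ : euler _ = ('X - x%:P) ^+ k * (('X * g) *+ k.+1 + ('X - x%:P) * ('X * g^`()))).
  rewrite IH hornerD hornerMn !hornerM hornerXsubC hornerX subrr mul0r addr0.
  by rewrite factS natrM exprS -mulr_natl; ring.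
rewrite /euler derivM deriv_exp derivXsubC mul1r succnK exprS -[in LHS]mulr_natl -[in RHS]mulr_natl.
by move: ('X - x%:P) (g^`()) (k.+1%:R) => Y g' c; move: (Y ^+ k) => Z; ring.
Qed.

Lemma euler_dvdp x n p : x != 0 -> (forall k, (k < n)%N -> (iter k euler p).[x] = 0) ->
  ('X - x%:P) ^+ n %| p.
Proof.
move=> x0; elim: n => [|n IH] h; first by rewrite expr0 dvd1p.
have /dvdpP[g pg] : ('X - x%:P) ^+ n %| p by apply: IH => k kn; apply: h; exact: ltnW.
have := h n (ltnSn n); rewrite {1}pg mulrC euler_leading => /eqP.
rewrite mulf_eq0 mulf_eq0 pnatr_eq0 expf_eq0 (negbTE x0) andbF orbF eqn0Ngt fact_gt0 /=.
rewrite -/(root g x) -dvdp_XsubCl => gx.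
by rewrite pg exprS dvdp_mul.
Qed.

Definition columns s : seq (C * nat) :=
  flatten [seq [seq (x, k) | k <- iota 0 (count_mem x s)] | x <- undup s].

Lemma size_columns s : size (columns s) = size s.
Proof.
rewrite -[RHS](perm_size (perm_count_undup s)) /columns !size_flatten /shape -!map_comp.
by congr sumn; apply: eq_map => x /=; rewrite size_map size_iota size_nseq.
Qed.

Lemma mem_columns s x k : ((x, k) \in columns s) = (k < count_mem x s)%N.
Proof.
apply/flattenP/idP => [[_ /mapP[y _ ->] /mapP[j]]|h].
  by rewrite mem_iota => /andP[_ jy] [-> ->].
exists [seq (x, k) | k <- iota 0 (count_mem x s)].
  apply/mapP; exists x => //; rewrite mem_undup -has_pred1 has_count.
  exact: leq_ltn_trans h.
by apply/mapP; exists k => //; rewrite mem_iota.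
Qed.

Section Matrices.
Variables (r : nat) (s : seq C).
Hypothesis r0 : (0 < r)%N.
Hypothesis sr : size s = r.

Definition conf_mx n : 'M[C]_(n, r) := \matrix_(q < n, c < r)
  let: (x, k) := nth (0, 0%N) (columns s) c in (q : nat)%:R ^+ k * x ^+ q.

(** The difference of ['X^q] and its remainder is a multiple of [root_poly s], which
    the iterates of the Euler operator of order less than the multiplicity of
    [x] send to a polynomial vanishing at [x]. *)
Lemma conf_mx_factor m : conf_mx m = rem_mx r m s *m conf_mx r.
Proof.
apply/matrixP => q c; rewrite !mxE.
have := mem_nth (0, 0%N) (_ : (c < size (columns s))%N).
rewrite size_columns sr ltn_ord => /(_ isT); case E: (nth _ _ _) => [x k]; rewrite mem_columns => kx.
have sz := size_rem_Xn q r0 (monic_root_poly s) _.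
rewrite size_root_poly sr in sz; have {}sz := sz erefl.
have : (iter k euler ('X^q - rem_Xn (root_poly s) r q)).[x] = 0.
  apply: euler_root kx; apply: dvdp_trans (dvdp_rem_Xn _ _ _).
  by rewrite -mup_geq ?mu_prod_XsubC // monic_neq0 // monic_root_poly.
rewrite eulerB hornerD hornerN => /eqP; rewrite subr_eq0.
rewrite (eval_euler _ _ sz) (@eval_euler _ 'X^q _ q.+1) ?size_polyXn //.
rewrite big_ord_recr /= coefXn eqxx mul1r big1 ?add0r => [/eqP ->|j _]; last first.
  by rewrite coefXn ltn_eqF ?ltn_ord // mul0r.
apply: eq_bigr => j _; by rewrite !mxE E.
Qed.

(** A vector in the left kernel is a polynomial of degree less than [r] for which
    all elements of [s], with multiplicities, are roots.  At [x = 0] the Euler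
    operator would not detect multiplicities. *)
Lemma conf_mx_unit : (forall x, x \in s -> x != 0) -> \det (conf_mx r) != 0.
Proof.
move=> s0; apply/negP => /det0P [u u0 uK].
pose p : {poly C} := rVpoly u.
have pr : (size p <= r)%N by exact: size_poly.
have p0 : p != 0.
  by apply: contra u0 => /eqP pz; rewrite -[u]rVpolyK -/p pz raddf0.
have van x k : (k < count_mem x s)%N -> (iter k euler p).[x] = 0.
  move=> kx; have xk : (x, k) \in columns s by rewrite mem_columns.
  have ck : (index (x, k) (columns s) < r)%N by rewrite -sr -size_columns index_mem.
  have := congr1 (fun M : 'rV[C]_r => M 0 (Ordinal ck)) uK; rewrite !mxE => <-.
  rewrite (eval_euler _ _ pr); apply: eq_bigr => j _.
  by rewrite !mxE /= nth_index // coef_rVpoly_ord.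
have [t pt] := closed_field_poly_normal p.
have : forall x, (count_mem x s <= count_mem x t)%N.
  move=> x; have [xs|xs] := boolP (x \in s); last by rewrite (count_memPn xs).
  have := euler_dvdp (s0 x xs) (@van x).
  by rewrite pt dvdpZr ?lead_coef_eq0 // -mup_geq ?mu_prod_XsubC // monic_neq0 // monic_prod_XsubC.
move=> /count_subseqP [s' s't /perm_size ss'].
have := size_subseq s't; rewrite -ss' sr leqNgt => /negP; apply.
by move: pr; rewrite pt size_scale ?lead_coef_eq0 // size_prod_XsubC.
Qed.

End Matrices.
End ConfluentVandermonde.

(** * Zeros outside the disc through w = 1/z *)

Section InverseDerivable.
Variable R : realType.
Local Notation C := (cplx R).
Implicit Types f g : C -> C.

Lemma derivable_factor f g (z : C) : (\forall w \near z, f w = f z + (w - z) * g w) ->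
  {for z, continuous g} -> derivable f z 1.
Proof.
move=> /nearP [d d0 hd] cg; apply/cvg_ex; exists (g z).
apply/(@cvgrPdist_lt _ _ _ _ (dnbhs_filter _)) => e e0.
have /cvgrPdist_lt /(_ _ e0) /nearP [d' d'0 hd'] := cg.
have [k [k0 kd kd']] := pos_min d0 d'0.
rewrite /dnbhs /within /=; apply/nearP; exists k => // h; rewrite subr0 => hk h0.
have hz : `|h + z - z| < k by rewrite addrK.
rewrite /= -[h *: 1]/(h * 1) mulr1 hd ?(lt_le_trans hz) // addrAC subrr add0r addrK.
rewrite -[_ *: _]/(h^-1 * (h * g (h + z))) mulKf //.
by apply: hd'; rewrite (lt_le_trans hz).
Qed.

Lemma disc_alg_continuous f (w : C) : disc_alg f -> `|w| < 1 -> {for w, continuous f}.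
Proof.
move=> hf w1; apply/(@cvgrPdist_lt _ _ _ _ (nbhs_filter w)) => e e0.
have [d d0 hd] := disc_alg_cont hf (ltW w1) e0.
have w1' : 0 < 1 - `|w| by rewrite subr_gt0.
have [k [k0 kd kw]] := pos_min d0 w1'.
apply/nearP; exists k => // v vk; rewrite distrC; apply: hd; last exact: lt_le_trans kd.
rewrite -(subrK w v) (le_trans (ler_normD _ _)) // -lerBrDr.
by rewrite (le_trans (ltW vk)).
Qed.

Lemma outside_ball (z v : C) : `|v - z| < `|z| - 1 -> 1 < `|v|.
Proof.
rewrite ltrBrDr => hv; have := ler_normD (z - v) v; rewrite subrK distrC => h.
by rewrite -(ltrD2l `|v - z|) (lt_le_trans hv).
Qed.

Lemma disc_alg_inv_derivable f (z : C) : disc_alg f -> 1 < `|z| ->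
  derivable (fun v : C => f v^-1 : C) z 1.
Proof.
move=> hf z1; have z0 : z != 0 by rewrite -normr_gt0 (lt_trans _ z1) // ltr01.
have zi (v : C) : 1 < `|v| -> `|v^-1| < 1.
  by move=> h; rewrite normfV invf_lt1 // (lt_trans _ h) // ltr01.
have [g hg fg] := disc_alg_div hf (zi _ z1).
apply: (@derivable_factor _ (fun v => - (z^-1 * v^-1) * g v^-1)).
  apply/nearP; exists (`|z| - 1); rewrite ?subr_gt0 // => v hv.
  have v1 := outside_ball hv.
  have v0 : v != 0 by rewrite -normr_gt0 (lt_trans _ v1) // ltr01.
  rewrite fg; last exact/ltW/zi.
  by field; rewrite z0 v0.
have ci : {for z, continuous (@GRing.inv C)} by exact: inv_continuous.
apply: continuousM.
  by apply: continuousN; apply: continuousM; [exact: cst_continuous|exact: ci].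
exact: (continuous_comp ci (disc_alg_continuous hg (zi _ z1))).
Qed.

(** With [w = z^-1], each factor [w - x] is [(z - x^-1) * (- x * w)]. *)
Lemma zero_order_exterior (K G h : C -> C) (zs : seq C) r (x : C) : disc_alg h ->
  (forall z, 1 < `|z| -> K z = z ^+ r * G z^-1) ->
  (forall w, `|w| <= 1 -> h w != 0) ->
  (forall w, `|w| <= 1 -> G w = \prod_(y <- zs) (w - y) * h w) ->
  x != 0 -> `|x| < 1 -> zero_order K x^-1 (count_mem x zs).
Proof.
move=> dh KG h0 Gh x0 x1; set k := count_mem x zs.
have z1 : 1 < `|x^-1| by rewrite normfV invf_gt1 ?normr_gt0.
pose F w := (- x * w) ^+ k * \prod_(y <- zs | y != x) (w - y) * h w.
have dF : disc_alg F.
  apply: disc_algM dh; apply: disc_algM.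
    by apply: disc_algX; apply: disc_algM; [exact: disc_alg_cst|exact: disc_alg_id].
  by apply: disc_alg_prod => y _; apply: disc_algB; [exact: disc_alg_id|exact: disc_alg_cst].
have near_out (P : C -> Prop) : (forall v, 1 < `|v| -> P v) -> \forall v \near x^-1, P v.
  move=> hP; apply/nearP; exists (`|x^-1| - 1); first by rewrite subr_gt0.
  by move=> v /outside_ball /hP.
exists (fun z => z ^+ r * F z^-1); split.
- apply: near_out => v v1; apply: derivableM; first exact: exprn_derivable.
  exact: disc_alg_inv_derivable.
- rewrite mulf_neq0 // ?expf_neq0 ?invr_eq0 // invrK mulf_neq0 ?h0 ?ltW // mulf_neq0 //.
    by rewrite expf_neq0 // mulf_neq0 ?oppr_eq0.
  by rewrite prodf_seq_neq0; apply/allP => y _; apply/implyP; rewrite subr_eq0 eq_sym.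
- apply: near_out => v v1; have v0 : v != 0 by rewrite -normr_gt0 (lt_trans _ v1) // ltr01.
  have w1 : `|v^-1| <= 1 by rewrite ltW // normfV invf_lt1 // (lt_trans _ v1) // ltr01.
  have e : \prod_(y <- zs | y == x) (v^-1 - y) = (v - x^-1) ^+ k * (- x * v^-1) ^+ k.
    rewrite -exprMn (eq_bigr (fun=> (v - x^-1) * (- x * v^-1))) => [|y /eqP ->].
      by rewrite big_const_seq iter_mulr_1.
    by field; rewrite v0 x0.
  by rewrite KG // Gh // /F (bigID (fun y => y == x)) /= e; ring.
Qed.

End InverseDerivable.

(** * The Kreiss-Lopatinskii determinant of the scheme *)

Section Scheme.
Variable R : realType.
Local Notation C := (cplx R).
Variables (r p m : nat) (a : int -> C) (b : int -> nat -> C).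
Hypothesis hr : (1 <= r)%N.
Hypothesis hp : (1 <= p)%N.
Hypothesis har : a (- r%:Z) != 0.
Hypothesis hap : a p%:Z != 0.
Hypothesis hstable : cauchy_stable r p a.

Definition symbol : {poly C} := \sum_(k < (r + p).+1) a (k%:Z - r%:Z) *: 'X^k.

Lemma roots_in_discE z : roots_in_disc r p a z = disc_roots symbol r z.
Proof. by []. Qed.

Lemma symbol_poly : symbol = \poly_(k < (r + p).+1) a (k%:Z - r%:Z).
Proof. by rewrite poly_def. Qed.

Lemma symbol_size : (r < (size symbol).-1)%N.
Proof.
rewrite symbol_poly size_poly_eq /=; first by rewrite -addn1 leq_add2l.
by rewrite PoszD addrAC subrr add0r.
Qed.

Lemma symbol0 : symbol.[0] != 0.
Proof. by rewrite horner_coef0 symbol_poly coef_poly /= sub0r. Qed.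

Lemma symbol_le1 (u : C) : `|u| = 1 -> `|symbol.[u]| <= 1.
Proof.
move=> u1; have [xi eu] := expi_surj u1; have u0 : u != 0 by rewrite -normr_gt0 u1.
have hs := hstable xi; suff e : symbol.[u] = u ^+ r * \sum_(k < (r + p).+1)
   a (k%:Z - r%:Z) * expi ((k%:Z - r%:Z)%:~R * xi).
  by rewrite e normrM normrX u1 expr1n mul1r.
rewrite /symbol horner_sum mulr_sumr; apply: eq_bigr => k _.
rewrite hornerZ hornerXn mulrCA; congr (_ * _).
rewrite rmorphB /= mulrBl expiD expiN !expi_muln -eu.
by rewrite mulrCA divff ?mulr1 // expf_neq0.
Qed.

(** This function extends [inner_roots] to the closed disc. *)
Definition inner_family (w : C) : seq C :=
  if w == 0 then nseq r 0 else inside_roots r p a w^-1.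

Lemma inner_familyE w : `|w| < 1 -> inner_family w = inner_roots symbol r w.
Proof.
rewrite /inner_family /inner_roots; case: eqVneq => // w0 w1.
by rewrite /inside_roots normfV invf_gt1 ?normr_gt0 // w1.
Qed.

Lemma inside_roots_limit (z0 : C) : `|z0| = 1 -> limit_roots r p a z0 (inside_roots r p a z0).
Proof.
move=> z01; have z00 : z0 != 0 by rewrite -normr_gt0 z01.
rewrite /inside_roots z01 ltxx.
have w01 : `|z0^-1| = 1 by rewrite normfV z01 invr1.
have [u ur hu] := inner_roots_limit hr symbol_size symbol0 symbol_le1 w01.
apply: (@xgetPex _ [::] [set s | limit_roots r p a z0 s]); exists u => /=; split=> // e e0.
have [d d0 hd] := hu e e0; apply/nearP; exists d => // z zd z1.
have zz : z != 0 by rewrite -normr_gt0 (lt_trans _ z1) // ltr01.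
have w1 : `|z^-1| < 1 by rewrite normfV invf_lt1 // (lt_trans _ z1) // ltr01.
have [|s' [h1 h2 h3]] := hd z^-1 w1.
  have -> : z^-1 - z0^-1 = (z0 - z) / (z * z0) by field; rewrite zz z00.
  rewrite normrM normfV normrM z01 mulr1 distrC (le_lt_trans _ zd) //.
  by rewrite ler_piMr // -normfV ltW.
exists s'; split => //; move: h1.
by rewrite /inner_roots invr_eq0 (negbTE zz) invrK roots_in_discE.
Qed.

Lemma size_inner_family w : `|w| <= 1 -> size (inner_family w) = r.
Proof.
move=> w1; have [w1'|w1'] := eqVneq `|w| 1; last first.
  by rewrite inner_familyE ?ltr1_norm // size_inner_roots ?ltr1_norm //; exact: symbol_le1.
have w0 : w != 0 by rewrite -normr_gt0 w1'.
rewrite /inner_family (negbTE w0).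
by have [] := @inside_roots_limit w^-1; first by rewrite normfV w1' invr1.
Qed.

Lemma inner_family_limit (w0 : C) : `|w0| = 1 -> forall e : C, 0 < e ->
  exists2 d : C, 0 < d & forall w, `|w| < 1 -> `|w - w0| < d ->
    close_roots r e (inner_roots symbol r w) (inner_family w0).
Proof.
move=> w01 e e0; have w00 : w0 != 0 by rewrite -normr_gt0 w01.
have z01 : `|w0^-1| = 1 by rewrite normfV w01 invr1.
have [_ /(_ e e0) /nearP [d d0 hd]] := inside_roots_limit z01.
have h0 : 0 < 2^-1 :> C by rewrite invr_gt0 ltr0n.
have [k [k0 kh kd]] := pos_min h0 (mulr_gt0 d0 h0).
exists k => // w w1 wk.
have w2 : 2^-1 < `|w| by apply: norm_gt_half w01 _; exact: lt_le_trans kh.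
have wn : w != 0 by rewrite -normr_gt0 (lt_trans h0).
have [||s' [h1 h2 h3]] := hd w^-1.
- have -> : w^-1 - w0^-1 = (w0 - w) / (w * w0) by field; rewrite wn w00.
  rewrite normrM normfV normrM w01 mulr1 distrC ltr_pdivrMr ?normr_gt0 //.
  rewrite (lt_le_trans wk) // (le_trans kd) // ler_pM2l // ltW //.
- by rewrite normfV invf_gt1 ?normr_gt0.
exists s'; split => //.
  by rewrite /inner_roots (negbTE wn) -roots_in_discE.
by rewrite /inner_family (negbTE w00).
Qed.

Lemma disc_alg_psum_family q : (0 < q)%N -> disc_alg (fun w => psum q (inner_family w)).
Proof.
move=> q0; apply: dilations_disc_alg => [rho p0 p1|w0 w01 e e0].
  apply: disc_alg_ext (disc_alg_psum hr symbol_size symbol0 symbol_le1 p0 p1 q0) => w w1.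
  rewrite inner_familyE // normrM gtr0_norm // (le_lt_trans (ler_piMr _ w1)) //.
  exact: ltW.
have [d d0 hd] := psum_cont q (inner_family w0) e0.
have [k k0 hk] := inner_family_limit w01 d0.
have s0 : size (inner_family w0) = r by rewrite size_inner_family // w01.
exists k => // w w1 wk; have [s' [h1 h2 h3]] := hk w w1 wk.
by rewrite inner_familyE // -(psum_perm q h1); apply: hd; rewrite s0.
Qed.

(** At a root [y] close to 0, [|symbol y| = |y| ^+ r / |w|] would be small,
    whereas [symbol] does not vanish at 0.  On the circle, [w] is approached from
    inside the disc. *)
Lemma inner_family_neq0 w x : `|w| <= 1 -> w != 0 -> x \in inner_family w -> x != 0.
Proof.
move=> w1 w0; have [w1'|w1'] := eqVneq `|w| 1; last first.
  rewrite inner_familyE ?ltr1_norm // /inner_roots (negbTE w0) mem_filter => /andP[_].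
  by rewrite (mem_all_roots symbol_size) => /(root_chi_neq0 hr symbol0).
move=> xw; apply/eqP => x0; rewrite {}x0 in xw.
pose eta := `|symbol.[0]| / 2; have eta0 : 0 < eta by rewrite divr_gt0 // normr_gt0 symbol0.
have /cvgrPdist_lt /(_ _ eta0) /nearP [d d0 hd] := @continuous_poly R symbol 0.
have h0 : 0 < 2^-1 :> C by rewrite invr_gt0 ltr0n.
have [e1 [e10 e1d e1h]] := pos_min d0 (mulr_gt0 eta0 h0).
have [k k0 hk] := inner_family_limit w1' e10.
have [k' [k'0 k'k k'h]] := pos_min k0 h0.
have [v v1 vw] := inside_point w1' k'0.
have [s' [h1 h2 h3]] := hk v v1 (lt_le_trans vw k'k).
have ir : (index (0%R : C) (inner_family w) < r)%N by rewrite -(size_inner_family w1) index_mem.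
have := h3 _ ir; rewrite nth_index // subr0; set y := s'`__ => ye.
have v2 : 2^-1 < `|v| by apply: norm_gt_half w1' _; exact: lt_le_trans k'h.
have vn : v != 0 by rewrite -normr_gt0 (lt_trans h0).
have : y \in inner_roots symbol r v by rewrite -(perm_mem h1) mem_nth // h2.
rewrite /inner_roots (negbTE vn) mem_filter => /andP[y1].
rewrite (mem_all_roots symbol_size) root_chi => /eqP hA.
have small : `|symbol.[y]| < eta.
  rewrite hA normrM normfV mulrC ltr_pdivrMr ?normr_gt0 //.
  apply: (@lt_trans _ _ (eta * 2^-1)); last by rewrite ltr_pM2l.
  rewrite (le_lt_trans _ (lt_le_trans ye e1h)) // normrX -(prednK hr) exprS.
  by rewrite ler_piMr // exprn_ile1 // ltW.
have := hd y; rewrite subr0 => /(_ (lt_le_trans ye e1d)) big.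
have := ler_normD (symbol.[0] - symbol.[y]) symbol.[y]; rewrite subrK => h.
have := le_lt_trans h (ltrD big small).
by rewrite -splitr ltxx.
Qed.

Let B := boundary_mx r p m a b.

(** In the coordinate [w], the determinant divided by [z ^+ r]. *)
Definition KL_disc (w : C) : C := \det (1%:M - w *: (B *m rem_mx r m (inner_family w))).

Lemma disc_alg_KL_disc : disc_alg KL_disc.
Proof.
apply: disc_alg_det_rem => //; [exact: size_inner_family|exact: disc_alg_psum_family].
Qed.

Lemma KL_detE z : 1 <= `|z| -> KL_det r p m a b z = z ^+ r * KL_disc z^-1.
Proof.
move=> z1; have z0 : z != 0 by rewrite -normr_gt0 (lt_le_trans _ z1) // ltr01.
have w1 : `|z^-1| <= 1 by rewrite normfV invf_le1 // (lt_le_trans _ z1) // ltr01.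
have fE : inner_family z^-1 = inside_roots r p a z.
  by rewrite /inner_family invr_eq0 (negbTE z0) invrK.
pose s := inside_roots r p a z.
have sr : size s = r by rewrite -(size_inner_family w1) fE.
have KE n : K_mx r p a n z = conf_mx r s n by [].
have K0 : \det (conf_mx r s r) != 0.
  by apply: conf_mx_unit => // x; rewrite /s -fE => /(inner_family_neq0 w1); apply; rewrite invr_eq0.
rewrite /KL_det !KE (conf_mx_factor hr sr m) mulmxA -mul_scalar_mx -mulmxBl det_mulmx mulfK //.
rewrite /KL_disc fE -/s -/B -detZ; congr (\det _).
by rewrite scalerBr scalerA divff // scale1r scalemx1.
Qed.

Lemma KL_disc0 : KL_disc 0 = 1.
Proof. by rewrite /KL_disc scale0r subr0 det1. Qed.

End Scheme.

Section ExteriorCount.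
Variable R : realType.
Local Notation C := (cplx R).

Lemma disc_alg_circle (G : C -> C) : disc_alg G -> circle_cont G.
Proof.
move=> dG; have := @disc_cont_circle R G 1 (disc_alg_cont dG); rewrite normr1 lexx => /(_ isT).
by apply: circle_cont_ext => x _; rewrite mulr1.
Qed.

Variables (K G : C -> C) (r : nat).
Hypothesis dG : disc_alg G.
Hypothesis G0 : G 0 != 0.
Hypothesis KG : forall z, 1 <= `|z| -> K z = z ^+ r * G z^-1.
Hypothesis K0 : forall z, `|z| = 1 -> K z != 0.

(** [expi t ^+ r] has argument [r t], and [(expi t)^-1 = expi (2 * pi - t)] runs
    through the circle backwards. *)
Lemma winding_exterior n : has_wind G n ->
  winding_number (fun t : R => K (expi t)) 0 (2 * pi) 0 (r%:Z - n).
Proof.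
move=> [phi [cphi phiE phi2pi]].
have KE t : K (expi t) = expi (r%:R * t) * G (expi (2 * pi - t)).
  by rewrite KG ?norm_expi // [expi (2 * pi - t)]expiD expi2pi mul1r expiN expi_muln.
have crt : continuous (fun t : R => r%:R * t) by exact: mulrl_continuous.
have crev : continuous (fun t : R => 2 * pi - t).
  by move=> t; apply: cvgB; [exact: cvg_cst|exact: cvg_id].
split.
- rewrite (_ : (fun t => _) = fun t => expi (r%:R * t) * G (expi (2 * pi - t))); last first.
    by apply/funext => t; exact: KE.
  apply: continuous_subspaceT => t.
  have c1 : {for t, continuous (fun t : R => expi (r%:R * t) : C)}.
    exact: (continuous_comp (crt t) (@continuous_expi R _)).
  have c2 : {for t, continuous (fun t : R => G (expi (2 * pi - t)))}.
    exact: (continuous_comp (crev t) (disc_alg_circle dG (x := _))).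
  exact: (continuousM c1 c2).
- by rewrite expi0 expi2pi.
- by move=> t _; apply: K0; rewrite norm_expi.
exists (fun t => r%:R * t + phi (2 * pi - t)); split.
- apply: continuous_subspaceT => t; apply: continuousD; first exact: crt.
  exact: (continuous_comp (crev t) (cphi _)).
- move=> t _; rewrite subr0 KE normrM norm_expi mul1r {1}phiE [expi (_ + phi _)]expiD; ring.
- rewrite subrr subr0 mulr0 add0r rmorphB /= mulrBr -phi2pi -pmulrn; ring.
Qed.

(** [G 0 != 0] says that [K] has no zero at infinity: every zero of [G] in the disc
    comes from a zero of [K]. *)
Theorem exterior_zeros : exists (ind : int) (N : nat),
  [/\ winding_number (fun t : R => K (expi t)) 0 (2 * pi) 0 ind,
      has_zeros K [set z | 1 < `|z|] N & N%:Z = r%:Z - ind].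
Proof.
have G1 x : `|x| = 1 -> G x != 0.
  move=> x1; have z1 : `|x^-1| = 1 by rewrite normfV x1 invr1.
  by have := K0 z1; rewrite KG ?z1 // invrK mulf_eq0 negb_or => /andP[].
have [zs [h [zs1 dh h0 Gh wG]]] := argument_principle dG G1.
exists (r%:Z - (size zs)%:Z), (size zs); split.
- exact: winding_exterior.
- have zs0 x : x \in zs -> x != 0.
    move=> xz; apply/eqP => x0; rewrite x0 in xz.
    by move: G0; rewrite Gh ?normr0 ?ler01 // (big_rem _ xz) /= subrr !mul0r eqxx.
  exists [seq x^-1 | x <- undup zs], (fun z => count_mem z^-1 zs); split.
  + by rewrite map_inj_uniq ?undup_uniq //; exact: invr_inj.
  + move=> z; split=> [/mapP[x] | [/= z1 /eqP]].
      rewrite mem_undup => xz -> /=; have z1 : 1 < `|x^-1|.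
        by rewrite normfV invf_gt1 ?zs1 // normr_gt0 zs0.
      split => //; rewrite KG ?ltW // invrK Gh ?ltW ?zs1 //.
      by rewrite (big_rem x) //= subrr !mul0r mulr0.
    have z0 : z != 0 by rewrite -normr_gt0 (lt_trans _ z1) // ltr01.
    have w1 : `|z^-1| <= 1 by rewrite ltW // normfV invf_lt1 // (lt_trans _ z1) // ltr01.
    rewrite KG ?ltW // Gh // !mulf_eq0 expf_eq0 (negbTE z0) andbF (negbTE (h0 _ w1)) orbF /=.
    rewrite prodf_seq_eq0 => /hasP[x xz]; rewrite subr_eq0 => /eqP zx.
    by apply/mapP; exists x; rewrite ?mem_undup // -zx invrK.
  + move=> z /mapP[x]; rewrite mem_undup => xz ->; rewrite invrK.
    apply: (zero_order_exterior dh _ h0 Gh) => [v v1||]; [|exact: zs0|exact: zs1].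
    by rewrite KG // ltW.
  rewrite big_map -[LHS](perm_size (perm_count_undup zs)) size_flatten /shape -map_comp.
  by rewrite sumnE big_map; apply: eq_bigr => x _ /=; rewrite size_nseq invrK.
- by rewrite opprB addrC subrK.
Qed.

End ExteriorCount.

Unset Implicit Arguments.

Theorem corollary14 (R : realType) (r p m : nat)
    (a : int -> cplx R) (b : int -> nat -> cplx R)
    (hr : (1 <= r)%N) (hp : (1 <= p)%N) (hm : (p + r <= m)%N)
    (har : a (- r%:Z) != 0) (hap : a p%:Z != 0)
    (hstable : cauchy_stable r p a)
    (hnz : forall z : cplx R, `|z| = 1 -> KL_det r p m a b z != 0) :
  exists (ind : int) (N : nat),
    [/\ winding_number (fun t : R => KL_det r p m a b (expi t)) 0 (2 * pi) 0 ind,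
        has_zeros (KL_det r p m a b) [set z | 1 < `|z|] N &
        N%:Z = r%:Z - ind].
Proof.
apply: (@exterior_zeros R _ (KL_disc r p m a b) r) => //.
- exact: disc_alg_KL_disc.
- by rewrite KL_disc0 oner_eq0.
- exact: KL_detE.
Qed.
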